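(* Let $\mathcal{H}$ be a family of finitely presented groups with decidable isomorphism problem. Then the isomorphism problem within the family $!\mathcal{H}$-by-$\mathbb{Z}$ is decidable if and only if, for every $H$ in $\mathcal{H}$, the $\mathrm{Out}$-semi-conjugacy problem of $H$ for deranged inputs, $\tfrac12\mathrm{CP}_H(\mathrm{Out}_{\mathsf d}(H))$, is decidable.
   Context: Families of groups are families of finite presentations closed under isomorphism of the presented groups. The isomorphism problem within a family $\mathcal{F}$ of finitely presented groups is: given two finite presentations of groups in $\mathcal{F}$, decide whether the groups presented are isomorphic. A group $G$ belongs to $!\mathcal{H}$-by-$\mathbb{Z}$ if $G$ has exactly one (as a subset) normal subgroup $H$ with $G/H\cong\mathbb{Z}$, and this $H$ belongs to $\mathcal{H}$. For a finitely generated group $H$ and $\alpha\in\mathrm{Aut}(H)$, let $H\rtimes_\alpha\mathbb{Z}$ be the semidirect product in which the generator $t$ of $\mathbb{Z}$ satisfies $tht^{-1}=\alpha(h)$ for $h\in H$. The automorphism $\alpha$ is deranged if $H\rtimes_\alpha\mathbb{Z}$ has a unique normal subgroup with quotient isomorphic to $\mathbb{Z}$; equivalently, the automorphism induced by $\alpha$ on $H^{\mathrm{ab}}$ modulo torsion has no nontrivial fixed points. Derangedness depends only on the class $[\alpha]\in\mathrm{Out}(H)$; $\mathrm{Out}_{\mathsf d}(H)$ denotes the set of deranged outer automorphisms. Two elements $g,h$ of a group are semi-conjugate if $g$ is conjugate to $h$ or to $h^{-1}$. For a group $H$ given by a finite presentation $\langle X\mid R\rangle$, the problem $\tfrac12\mathrm{CP}_H(\mathrm{Out}_{\mathsf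 d}(H))$ is: given two deranged automorphisms $\alpha,\beta\in\mathrm{Aut}(H)$, each specified by words in $X^{\pm1}$ representing the images of the generators in $X$, decide whether $[\alpha]$ and $[\beta]$ are semi-conjugate in $\mathrm{Out}(H)$.
   Formalization: ''For every H in 𝓗, ½CP_H(Out_d(H)) is decidable'' is taken uniformly: one algorithm, given a presentation of H as part of the input, solves the problem for all H in 𝓗; with a separate unrelated algorithm for each H the ''if'' direction fails. *)

(* Defs.v *)
From HB Require Import structures.
From mathcomp Require Import all_boot ssralg ssrint.
From mathcomp Require Import boolp.

Set Implicit Arguments.
Unset Strict Implicit.
Unset Printing Implicit Defensive.

Local Open Scope quotient_scope.
Local Open Scope group_scope.

(** * Groups *)

Definition isog (G H : groupType) : Prop :=
  exists f : {multiplicative G -> H}, bijective f.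

Definition conjugate (G : groupType) (x y : G) : Prop := exists z : G, x = y ^ z.

Definition semi_conjugate (G : groupType) (x y : G) : Prop :=
  conjugate x y \/ conjugate x y^-1.

Definition expz (G : groupType) (x : G) (m : int) : G :=
  match m with Posz n => x ^+ n | Negz n => x ^- n.+1 end.

Section ExpzTheory.
Variables (G : groupType) (x : G).

Lemma expzS m : expz x (m + 1)%R = expz x m * x.
Proof.
case: m => [n|[|n]] /=; first by rewrite addn1 expgSr.
  by rewrite mulVg.
by rewrite subn1 /= [in RHS]expgS invgM -mulgA mulVg mulg1.
Qed.

Lemma expzP m : expz x (m - 1)%R = expz x m * x^-1.
Proof. by rewrite -{2}(GRing.subrK 1%R m) expzS mulgK. Qed.

Lemma expzD m n : expz x (m + n)%R = expz x m * expz x n.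
Proof.
elim/int_rect: n => [|n IHn|n IHn].
- by rewrite GRing.addr0 /= mulg1.
- by rewrite intS [(1 + _)%R]GRing.addrC GRing.addrA !expzS IHn mulgA.
- by rewrite intS GRing.opprD [(-1 + _)%R]GRing.addrC GRing.addrA !expzP IHn
             mulgA.
Qed.

Lemma expzN m : expz x (- m)%R = (expz x m)^-1.
Proof.
by apply: (mulgI (expz x m)); rewrite -expzD GRing.subrr mulgV.
Qed.

End ExpzTheory.

(* The integers as a multiplicative group. *)
Definition infinite_cyclic : Type := int.

HB.instance Definition _ := Choice.on infinite_cyclic.
HB.instance Definition _ := isGroup.Build infinite_cyclic
  (@GRing.addrA int) (@GRing.add0r int) (@GRing.addr0 int)
  (@GRing.addNr int) (@GRing.addrN int).

(** * Normal subgroups and quotients *)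

Record normal_subgroup (G : groupType) := NormalSubgroup {
  nsub : pred G;
  nsub_closed : group_closed nsub;
  nsub_conj : forall x y : G, x \in nsub -> x ^ y \in nsub
}.

Section Subgroup.
Variables (G : groupType) (N : normal_subgroup G).

Record subgroup := Subgroup { sub_elt :> G; sub_eltP : nsub N sub_elt }.

HB.instance Definition _ := [isSub for sub_elt].
HB.instance Definition _ := [Choice of subgroup by <:].
HB.instance Definition _ :=
  SubChoice_isSubGroup.Build G (nsub N) subgroup (nsub_closed N).

End Subgroup.

Section Quotient.
Variables (G : groupType) (N : normal_subgroup G).

Lemma nsub1 : 1 \in nsub N.
Proof. exact: (nsub_closed N).1. Qed.

Lemma nsubM x y : x \in nsub N -> y \in nsub N -> x * y \in nsub N.
Proof. exact: (group_closedM (nsub_closed N)). Qed.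

Lemma nsubV x : x \in nsub N -> x^-1 \in nsub N.
Proof. exact: (group_closedV (nsub_closed N)). Qed.

Definition coset_rel : rel G := fun x y => x^-1 * y \in nsub N.

Lemma coset_rel_refl : reflexive coset_rel.
Proof. by move=> x; rewrite /coset_rel mulVg nsub1. Qed.

Lemma coset_rel_sym : symmetric coset_rel.
Proof.
have imp x y : coset_rel x y -> coset_rel y x.
  by move=> /nsubV; rewrite invgM invgK.
by move=> x y; apply/idP/idP => /imp.
Qed.

Lemma coset_rel_trans : transitive coset_rel.
Proof.
move=> y x z xy yz; rewrite /coset_rel.
have -> : x^-1 * z = (x^-1 * y) * (y^-1 * z) by rewrite -mulgA mulVKg.
exact: nsubM.
Qed.

Canonical coset_equiv :=
  EquivRel coset_rel coset_rel_refl coset_rel_sym coset_rel_trans.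

Definition quotient_group := {eq_quot coset_equiv}.

HB.instance Definition _ := Choice.on quotient_group.
HB.instance Definition _ := Quotient.on quotient_group.

Definition coset (x : G) : quotient_group := \pi_quotient_group x.

Lemma coset_eqP x y : reflect (coset x = coset y) (coset_rel x y).
Proof. exact: (@eqmodP _ coset_equiv). Qed.

Definition coset_mul (a b : quotient_group) := coset (repr a * repr b).
Definition coset_inv (a : quotient_group) := coset (repr a)^-1.

Lemma cosetM x y : coset_mul (coset x) (coset y) = coset (x * y).
Proof.
apply/esym/coset_eqP; rewrite /coset_rel.
have hx : coset_rel x (repr (coset x)) by apply/coset_eqP; rewrite /coset reprK.
have hy : coset_rel y (repr (coset y)) by apply/coset_eqP; rewrite /coset reprK.
move: (repr (coset x)) (repr (coset y)) hx hy => x' y' hx hy.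
have -> : (x * y)^-1 * (x' * y') = (x^-1 * x') ^ y * (y^-1 * y').
  by rewrite /conjg invgM !mulgA mulgK.
by apply: nsubM => //; apply: nsub_conj.
Qed.

Lemma cosetV x : coset_inv (coset x) = coset x^-1.
Proof.
apply/esym/coset_eqP; rewrite /coset_rel invgK.
have: coset_rel x (repr (coset x)) by apply/coset_eqP; rewrite /coset reprK.
move: (repr (coset x)) => x' /nsubV /(nsub_conj x^-1).
by rewrite /conjg invgM !invgK mulgK.
Qed.

Lemma cosetW (P : quotient_group -> Prop) :
  (forall x, P (coset x)) -> forall a, P a.
Proof. by move=> h a; rewrite -[a]reprK; apply: h. Qed.

Lemma coset_mulA : associative coset_mul.
Proof.
elim/cosetW=> x; elim/cosetW=> y; elim/cosetW=> z.
by rewrite !cosetM mulgA.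
Qed.

Lemma coset_mul1g : left_id (coset 1) coset_mul.
Proof. by elim/cosetW=> x; rewrite cosetM mul1g. Qed.

Lemma coset_mulg1 : right_id (coset 1) coset_mul.
Proof. by elim/cosetW=> x; rewrite cosetM mulg1. Qed.

Lemma coset_mulVg : left_inverse (coset 1) coset_inv coset_mul.
Proof. by elim/cosetW=> x; rewrite cosetV cosetM mulVg. Qed.

Lemma coset_mulgV : right_inverse (coset 1) coset_inv coset_mul.
Proof. by elim/cosetW=> x; rewrite cosetV cosetM mulgV. Qed.

HB.instance Definition _ := isGroup.Build quotient_group
  coset_mulA coset_mul1g coset_mulg1 coset_mulVg coset_mulgV.

End Quotient.

Definition infinite_cyclic_quotient (G : groupType) (N : normal_subgroup G) :=
  isog (quotient_group N) infinite_cyclic.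

Definition only_Z_kernel (G : groupType) (N : normal_subgroup G) : Prop :=
  infinite_cyclic_quotient N /\
  (forall N' : normal_subgroup G, infinite_cyclic_quotient N' -> nsub N' =i nsub N).

(** * Automorphisms and outer automorphisms *)

Record automorphism (H : groupType) := Automorphism {
  aut_fun :> H -> H;
  aut_inv : H -> H;
  aut_funM : {morph aut_fun : x y / x * y};
  aut_funK : cancel aut_fun aut_inv;
  aut_invK : cancel aut_inv aut_fun
}.

Section AutomorphismGroup.
Variable H : groupType.
Implicit Types a b c : automorphism H.

HB.instance Definition _ := gen_eqMixin (automorphism H).
HB.instance Definition _ := gen_choiceMixin (automorphism H).

Lemma autP a b : a =1 b -> a = b.
Proof.
case: a b => [f f' fM fK f'K] [g g' gM gK g'K] /= /funext fg; subst g.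
have e : f' = g' by apply/funext => x; rewrite -[x in LHS]g'K fK.
by subst g'; congr Automorphism; apply: Prop_irrelevance.
Qed.

Lemma aut_invM a : {morph aut_inv a : x y / x * y}.
Proof.
by move=> x y; apply: (can_inj (aut_funK a)); rewrite aut_funM !aut_invK.
Qed.

Definition aut_one : automorphism H :=
  @Automorphism H id id (fun _ _ => erefl) (fun _ => erefl) (fun _ => erefl).

Definition aut_V a : automorphism H :=
  Automorphism (aut_invM a) (aut_invK a) (aut_funK a).

Fact aut_compM a b : {morph a \o b : x y / x * y}.
Proof. by move=> x y /=; rewrite !aut_funM. Qed.

Definition aut_comp a b : automorphism H :=
  @Automorphism H (a \o b) (aut_inv b \o aut_inv a) (aut_compM a b)
    (can_comp (aut_funK a) (aut_funK b)) (can_comp (aut_invK b) (aut_invK a)).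

Fact aut_compA : associative aut_comp.
Proof. by move=> a b c; apply: autP. Qed.
Fact aut_comp1 : left_id aut_one aut_comp.
Proof. by move=> a; apply: autP. Qed.
Fact aut_comp1r : right_id aut_one aut_comp.
Proof. by move=> a; apply: autP. Qed.
Fact aut_compV : left_inverse aut_one aut_V aut_comp.
Proof. by move=> a; apply: autP => x /=; rewrite aut_funK. Qed.
Fact aut_compVr : right_inverse aut_one aut_V aut_comp.
Proof. by move=> a; apply: autP => x /=; rewrite aut_invK. Qed.

HB.instance Definition _ := isGroup.Build (automorphism H)
  aut_compA aut_comp1 aut_comp1r aut_compV aut_compVr.

Lemma autM a b x : (a * b) x = a (b x). Proof. by []. Qed.
Lemma aut1 x : (1 : automorphism H) x = x. Proof. by []. Qed.
Lemma autV a x : (a^-1) x = aut_inv a x. Proof. by []. Qed.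

Lemma aut_fun1 a : a 1 = 1.
Proof. by apply: (mulgI (a 1)); rewrite -aut_funM !mulg1. Qed.

Lemma aut_funV a x : a x^-1 = (a x)^-1.
Proof. by apply: (mulgI (a x)); rewrite -aut_funM !mulgV aut_fun1. Qed.

Definition is_inner : pred (automorphism H) :=
  fun a => `[< exists g : H, forall x, a x = g * x * g^-1 >].

Fact is_inner_closed : group_closed is_inner.
Proof.
split; first by apply/asboolP; exists 1 => x; rewrite mul1g invg1 mulg1.
move=> a b /asboolP[g ag] /asboolP[h bh]; apply/asboolP.
exists (g * h^-1) => x; rewrite autM ag autV.
have -> : aut_inv b x = h^-1 * x * h.
  by apply: (can_inj (aut_funK b)); rewrite aut_invK bh !mulgA mulgV mul1g mulgK.
by rewrite invgM invgK !mulgA.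
Qed.

Fact is_inner_conj a b : a \in is_inner -> a ^ b \in is_inner.
Proof.
move=> /asboolP[g ag]; apply/asboolP; exists (aut_inv b g) => x.
rewrite /conjg !autM ag autV !aut_invM aut_funK; congr (_ * _).
exact: (aut_funV b^-1).
Qed.

Definition inner_automorphisms : normal_subgroup (automorphism H) :=
  NormalSubgroup is_inner_closed is_inner_conj.

End AutomorphismGroup.

Definition outer_group (H : groupType) : groupType :=
  quotient_group (inner_automorphisms H).

Definition outer_class (H : groupType) (a : automorphism H) : outer_group H :=
  coset (inner_automorphisms H) a.

(** * Mapping tori *)

(* The pair (h, m) stands for h t^m, where t h t^-1 = a(h). *)
Definition mapping_torus (H : groupType) (a : automorphism H) : Type :=
  (H * int)%type.

Section MappingTorus.
Variables (H : groupType) (a : automorphism H).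

HB.instance Definition _ := Choice.copy (mapping_torus a) (H * int)%type.

Definition torus_one : mapping_torus a := (1, 0%R).

Definition torus_mul (u v : mapping_torus a) : mapping_torus a :=
  (u.1 * expz a u.2 v.1, (u.2 + v.2)%R).

Definition torus_inv (u : mapping_torus a) : mapping_torus a :=
  ((expz a (- u.2)%R u.1)^-1, (- u.2)%R).

Fact torus_mulA : associative torus_mul.
Proof.
by move=> [h k] [h' k'] [h'' k'']; rewrite /torus_mul /= aut_funM expzD autM
  GRing.addrA mulgA.
Qed.

Fact torus_mul1g : left_id torus_one torus_mul.
Proof. by case=> h k; rewrite /torus_mul /= mul1g GRing.add0r. Qed.

Fact torus_mulg1 : right_id torus_one torus_mul.
Proof. by case=> h k; rewrite /torus_mul /= aut_fun1 mulg1 GRing.addr0. Qed.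

Fact torus_mulVg : left_inverse torus_one torus_inv torus_mul.
Proof.
by case=> h k; rewrite /torus_mul /torus_inv /= mulVg GRing.addNr.
Qed.

Fact torus_mulgV : right_inverse torus_one torus_inv torus_mul.
Proof.
case=> h k; rewrite /torus_mul /torus_inv /= aut_funV -autM -expzD.
by rewrite GRing.addrN mulgV.
Qed.

HB.instance Definition _ := isGroup.Build (mapping_torus a)
  torus_mulA torus_mul1g torus_mulg1 torus_mulVg torus_mulgV.

End MappingTorus.

Definition deranged (H : groupType) (a : automorphism H) : Prop :=
  exists N : normal_subgroup (mapping_torus a), only_Z_kernel N.

(** * Finite presentations *)

(* (i, false) is the generator x_i and (i, true) is its inverse. *)
Definition letter (n : nat) : Type := ('I_n * bool)%type.
Definition word (n : nat) : Type := seq ('I_n * bool).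

Definition letter_inv n (x : letter n) : letter n := (x.1, ~~ x.2).
Definition word_inv n (w : word n) : word n := rev (map (@letter_inv n) w).

Record presentation := Presentation {
  gens : nat;
  rels : seq (word gens)
}.

Inductive word_eq (P : presentation) : word (gens P) -> word (gens P) -> Prop :=
| weq_refl u : word_eq u u
| weq_sym u v : word_eq u v -> word_eq v u
| weq_trans u v w : word_eq u v -> word_eq v w -> word_eq u w
| weq_cat u u' v v' : word_eq u u' -> word_eq v v' -> word_eq (u ++ v) (u' ++ v')
| weq_cancel x : word_eq [:: x; letter_inv x] [::]
| weq_rel r : r \in rels P -> word_eq r [::].

Section PresentedGroup.
Variable P : presentation.
Implicit Types u v w : word (gens P).

Definition word_eqb : rel (seq ('I_(gens P) * bool)) :=
  fun u v => `[< word_eq (P := P) u v >].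

Fact word_eqb_refl : reflexive word_eqb.
Proof. by move=> u; apply/asboolP/weq_refl. Qed.

Fact word_eqb_sym : symmetric word_eqb.
Proof. by move=> u v; apply/asboolP/asboolP => /weq_sym. Qed.

Fact word_eqb_trans : transitive word_eqb.
Proof.
by move=> v u w /asboolP uv /asboolP vw; apply/asboolP/(weq_trans uv vw).
Qed.

Canonical word_equiv :=
  EquivRel word_eqb word_eqb_refl word_eqb_sym word_eqb_trans.

Definition presented_group := {eq_quot word_equiv}.

HB.instance Definition _ := Choice.on presented_group.
HB.instance Definition _ := Quotient.on presented_group.

Definition word_val (w : word (gens P)) : presented_group :=
  \pi_presented_group w.

Lemma word_val_eqP u v : word_val u = word_val v <-> word_eq (P := P) u v.
Proof.
split=> [/(@eqmodP _ word_equiv)/asboolP //|uv].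
by apply/(@eqmodP _ word_equiv)/asboolP.
Qed.

Definition presented_mul (g h : presented_group) := word_val (repr g ++ repr h).
Definition presented_inv (g : presented_group) := word_val (word_inv (repr g)).

Lemma word_inv_cat u v : word_inv (u ++ v) = word_inv v ++ word_inv u.
Proof. by rewrite /word_inv map_cat rev_cat. Qed.

Lemma letter_invK : involutive (@letter_inv (gens P)).
Proof. by case=> i b; rewrite /letter_inv /= negbK. Qed.

Lemma word_invK : involutive (@word_inv (gens P)).
Proof.
by move=> u; rewrite /word_inv map_rev revK -map_comp map_id_in // => x _;
  apply: letter_invK.
Qed.

Lemma weq_catV u : word_eq (P := P) (u ++ word_inv u) [::].
Proof.
elim: u => [|x u IHu]; first exact: weq_refl.
rewrite -[x :: u]/([:: x] ++ u) word_inv_cat -!catA [u ++ _]catA.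
apply: weq_trans (weq_cancel x).
apply: (weq_cat (u := [:: x]) (weq_refl _)).
exact: (weq_cat IHu (weq_refl _)).
Qed.

Lemma weq_Vcat u : word_eq (P := P) (word_inv u ++ u) [::].
Proof. by have := weq_catV (word_inv u); rewrite word_invK. Qed.

Lemma weq_inv u v :
  word_eq (P := P) u v -> word_eq (P := P) (word_inv u) (word_inv v).
Proof.
move=> uv; rewrite -[word_inv v]cats0 -[word_inv u]cat0s.
apply: weq_trans (weq_cat (weq_refl _) (weq_catV u)).
rewrite catA; apply: weq_cat (weq_refl _).
apply: weq_sym; apply: weq_trans (weq_Vcat v).
exact: weq_cat (weq_refl _) uv.
Qed.

Lemma word_valM u v : presented_mul (word_val u) (word_val v) = word_val (u ++ v).
Proof.
by apply/word_val_eqP; apply: weq_cat; apply/word_val_eqP; rewrite /word_val reprK.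
Qed.

Lemma word_valV u : presented_inv (word_val u) = word_val (word_inv u).
Proof.
by apply/word_val_eqP; apply: weq_inv; apply/word_val_eqP; rewrite /word_val reprK.
Qed.

Lemma word_valW (Q : presented_group -> Prop) :
  (forall w, Q (word_val w)) -> forall g, Q g.
Proof. by move=> h g; rewrite -[g]reprK; apply: h. Qed.

Fact presented_mulA : associative presented_mul.
Proof.
elim/word_valW=> u; elim/word_valW=> v; elim/word_valW=> w.
by rewrite !word_valM catA.
Qed.

Fact presented_mul1g : left_id (word_val [::]) presented_mul.
Proof. by elim/word_valW=> u; rewrite word_valM. Qed.

Fact presented_mulg1 : right_id (word_val [::]) presented_mul.
Proof. by elim/word_valW=> u; rewrite word_valM cats0. Qed.

Fact presented_mulVg : left_inverse (word_val [::]) presented_inv presented_mul.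
Proof.
elim/word_valW=> u; rewrite word_valV word_valM.
by apply/word_val_eqP/weq_Vcat.
Qed.

Fact presented_mulgV : right_inverse (word_val [::]) presented_inv presented_mul.
Proof.
elim/word_valW=> u; rewrite word_valV word_valM.
by apply/word_val_eqP/weq_catV.
Qed.

HB.instance Definition _ := isGroup.Build presented_group
  presented_mulA presented_mul1g presented_mulg1 presented_mulVg presented_mulgV.

Definition generator (i : 'I_(gens P)) : presented_group :=
  word_val [:: (i, false)].

End PresentedGroup.

(* The images of the generators, as words in the generators. *)
Definition images (P : presentation) : Type := (gens P).-tuple (word (gens P)).

Definition represents (P : presentation) (ws : images P)
    (a : automorphism (presented_group P)) : Prop :=
  forall i : 'I_(gens P), a (generator i) = word_val (tnth ws i).

(** * Families of finitely presented groups *)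

Definition iso_closed (F : presentation -> Prop) : Prop :=
  forall P Q, F P -> isog (presented_group P) (presented_group Q) -> F Q.

Definition in_family (F : presentation -> Prop) (G : groupType) : Prop :=
  exists2 P, F P & isog (presented_group P) G.

Definition unique_by_Z (F : presentation -> Prop) : presentation -> Prop :=
  fun P => exists N : normal_subgroup (presented_group P),
    only_Z_kernel N /\ in_family F (subgroup N).

(** * Partial recursive functions *)

(* Kleene's mu-recursive functions. Arities are left implicit: a program is run
   on a list of arguments, and an argument which is missing is read as 0. *)
Inductive prog : Type :=
| Zero
| Succ
| Proj of nat
| Comp of prog & seq prog
| PrimRec of prog & prog
| Mu of prog.

Inductive eval : prog -> seq nat -> nat -> Prop :=
| eval_zero xs : eval Zero xs 0
| eval_succ xs : eval Succ xs (nth 0 xs 0).+1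
| eval_proj i xs : eval (Proj i) xs (nth 0 xs i)
| eval_comp f gs xs ys y : evals gs xs ys -> eval f ys y -> eval (Comp f gs) xs y
| eval_rec0 f g xs y : eval f xs y -> eval (PrimRec f g) (0 :: xs) y
| eval_recS f g n xs r y :
    eval (PrimRec f g) (n :: xs) r -> eval g (n :: r :: xs) y ->
    eval (PrimRec f g) (n.+1 :: xs) y
| eval_mu f xs n (v : nat -> nat) :
    (forall i, i < n -> eval f (i :: xs) (v i).+1) -> eval f (n :: xs) 0 ->
    eval (Mu f) xs n
with evals : seq prog -> seq nat -> seq nat -> Prop :=
| evals_nil xs : evals [::] xs [::]
| evals_cons g gs xs y ys :
    eval g xs y -> evals gs xs ys -> evals (g :: gs) xs (y :: ys).

Scheme eval_mutind := Minimality for eval Sort Prop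
with evals_mutind := Minimality for evals Sort Prop.

Lemma eval_functional p xs y z : eval p xs y -> eval p xs z -> y = z.
Proof.
move=> ev; move: p xs y ev z; apply: (eval_mutind
  (P := fun p xs y => forall z, eval p xs z -> y = z)
  (P0 := fun gs xs ys => forall zs, evals gs xs zs -> ys = zs)).
- by move=> xs z ev; inversion ev.
- by move=> xs z ev; inversion ev.
- by move=> i xs z ev; inversion ev.
- move=> f gs xs ys y _ IHgs _ IHf z ev; inversion ev; subst.
  by apply: IHf; match goal with h : evals _ _ _ |- _ => rewrite (IHgs _ h) end.
- by move=> f g xs y _ IH z ev; inversion ev; subst; apply: IH.
- move=> f g n xs r y _ IHr _ IHy z ev; inversion ev; subst.
  apply: IHy.
  by match goal with h : eval (PrimRec _ _) _ _ |- _ => rewrite (IHr _ h) end.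
- move=> f xs n v _ IHv _ IH0 z ev; inversion ev; subst.
  case: (ltngtP n z) => // lt.
  - by match goal with h : forall i, is_true (i < z) -> _ |- _ => have := IH0 _ (h _ lt) end.
  - by match goal with h : eval f (z :: xs) 0 |- _ => have := IHv _ lt _ h end.
- by move=> xs zs ev; inversion ev.
- move=> g gs xs y ys _ IHg _ IHgs zs ev; inversion ev; subst.
  match goal with h : eval g _ _, h' : evals gs _ _ |- _ =>
    by rewrite (IHg _ h) (IHgs _ h') end.
Qed.

(** * Decision problems *)

(* Algorithms receive [code x] and are only required to be correct (and to
   halt) on the instances [x] that satisfy the promise. *)
Record problem := Problem {
  instance : Type;
  code : instance -> seq nat;
  promise : instance -> Prop;
  answer : instance -> Prop
}.

Definition decides (p : prog) (D : problem) : Prop :=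
  forall x : instance D, promise x ->
    (answer x -> eval p (code x) 1) /\ (~ answer x -> eval p (code x) 0).

Definition decidable_problem (D : problem) : Prop := exists p, decides p D.

Definition code_letter n (x : letter n) : nat := x.1.*2 + x.2.

Definition code_word n (w : word n) : nat :=
  CodeSeq.code (map (@code_letter n) w).

Definition code_words n (ws : seq (word n)) : nat :=
  CodeSeq.code (map (@code_word n) ws).

Definition code_presentation (P : presentation) : nat :=
  CodeSeq.code [:: gens P; code_words (rels P)].

Definition isomorphism_problem (F : presentation -> Prop) : problem := {|
  instance := presentation * presentation;
  code := fun x => [:: code_presentation x.1; code_presentation x.2];
  promise := fun x => F x.1 /\ F x.2;
  answer := fun x => isog (presented_group x.1) (presented_group x.2)
|}.

(* The presentation of the group is handed to the algorithm together with the
   two automorphisms. *)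
Definition deranged_semi_conjugacy_problem (P : presentation) : problem := {|
  instance := images P * images P;
  code := fun x => [:: code_presentation P; code_words x.1; code_words x.2];
  promise := fun x => exists a b : automorphism (presented_group P),
    [/\ represents x.1 a, represents x.2 b, deranged a & deranged b];
  answer := fun x => exists a b : automorphism (presented_group P),
    [/\ represents x.1 a, represents x.2 b
      & semi_conjugate (outer_class a) (outer_class b)]
|}.

(* One algorithm serves all the groups of the family: the group [H] is part of
   the input, and the algorithm for [H] is obtained effectively from its
   presentation. *)
Definition deranged_semi_conjugacy_decidable (F : presentation -> Prop) : Prop :=
  exists p : prog, forall P : presentation, F P ->
    decides p (deranged_semi_conjugacy_problem P).

(* Main.v *)
From HB Require Import structures.
From mathcomp Require Import all_boot ssralg ssrint.
From mathcomp Require Import boolp.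
Require Import Defs.

Set Implicit Arguments.
Unset Strict Implicit.
Unset Printing Implicit Defensive.

(** A group [G] with a normal subgroup [N] and quotient Z is the mapping torus of
    the automorphism by which a lift [t] of a generator of Z acts on [N]
    ([isog_torus]). If [N] is the only such subgroup, then an isomorphism onto
    another group of this kind carries kernel to kernel and sends [t] to
    [c t^e] with [e] = 1 or -1. Hence two such groups have isomorphic kernels
    whenever they are isomorphic ([torus_isog_fiber]), and over one and the same
    kernel they are isomorphic exactly when their monodromies are
    semi-conjugate up to inner automorphisms ([torus_isog_semi_conjugate]). The
    theorem is the effective form of this classification.

    From isomorphism to semi-conjugacy: if the words w_i represent the images of
    the generators x_i under an automorphism of < X | R >, its mapping torus is
    < X, t | R, w_i t x_i^-1 t^-1 > ([torus_presentation_isog]), and this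
    presentation is computed from the given one. So deciding semi-conjugacy
    amounts to deciding isomorphism of two mapping tori.

    From semi-conjugacy to isomorphism: a decomposition of a given group as a
    mapping torus is witnessed by finite data, namely words for the monodromy and
    its inverse, words for an isomorphism and its inverse, and derivations of all
    the equations between words that these must satisfy. Decompositions
    therefore form a semidecidable set ([semidecidable_decomposes]), and since
    every group of the family has one, a search finds it. The fibre that turns
    up lies in F, because it is isomorphic to the unique kernel and F is closed
    under isomorphism ([unique_by_Z_torus]). Decompose both groups and decide
    whether the fibres are isomorphic; if they are, the second group is also a
    mapping torus over the fibre of the first, a further search finds the
    monodromy, and semi-conjugacy decides.

    To exhibit the algorithms as recursive programs, data made of numbers, pairs
    and sequences are encoded by numbers, words being sequences of numbered
    letters. Computable functions are shown to be closed under the usual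
    operations on such data, and semidecidable predicates under conjunction,
    quantification over the entries of a sequence, and existential
    quantification. *)

(** * Computable functions of natural numbers *)

(** The arity is fixed because a recursion can only receive its parameters
    through an explicit list of projections. *)
Definition nat_computable k (f : seq nat -> nat) : Prop :=
  exists p, forall xs, size xs = k -> eval p xs (f xs).

Lemma nat_computable_ext k f g :
  nat_computable k f -> (forall xs, size xs = k -> f xs = g xs) ->
  nat_computable k g.
Proof. by move=> [p pf] fg; exists p => xs sz; rewrite -fg //; apply: pf. Qed.

Lemma evals_projections xs s :
  evals (map Proj s) xs (map (nth 0 xs) s).
Proof.
elim: s => [|i s IHs] /=; first exact: evals_nil.
by apply: evals_cons => //; apply: eval_proj.
Qed.

Lemma nat_computable_nth k i : nat_computable k (fun xs => nth 0 xs i).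
Proof. by exists (Proj i) => xs _; apply: eval_proj. Qed.

Lemma nat_computable_succ k f :
  nat_computable k f -> nat_computable k (fun xs => (f xs).+1).
Proof.
move=> [p pf]; exists (Comp Succ [:: p]) => xs sz.
apply: (@eval_comp _ _ _ [:: f xs]); last exact: (eval_succ [:: f xs]).
by apply: evals_cons; [apply: pf | apply: evals_nil].
Qed.

Lemma nat_computable0 k : nat_computable k (fun=> 0).
Proof. by exists Zero => xs _; apply: eval_zero. Qed.

Lemma nat_computable_const k c : nat_computable k (fun=> c).
Proof.
elim: c => [|c IHc]; first exact: nat_computable0.
exact: nat_computable_succ.
Qed.

Lemma nat_computable_behead k f :
  nat_computable k f -> nat_computable k.+1 (fun xs => f (behead xs)).
Proof.
move=> [p pf]; exists (Comp p (map Proj (iota 1 k))) => -[//|x xs] [sz] /=.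
apply: eval_comp (pf _ sz).
have {2}-> : xs = map (nth 0 (x :: xs)) (iota 1 k).
  by rewrite -[1]/(1 + 0) iotaDl -map_comp -sz map_nth_iota0 // take_size.
exact: evals_projections.
Qed.

Lemma nat_computable_rec k n z g :
  nat_computable k n -> nat_computable k z -> nat_computable k.+2 g ->
  nat_computable k
    (fun xs => iteri (n xs) (fun i r => g [:: i, r & xs]) (z xs)).
Proof.
move=> [pn evn] [pz evz] [pg evg].
exists (Comp (PrimRec pz pg) (pn :: map Proj (iota 0 k))) => xs sz.
apply: (@eval_comp _ _ _ (n xs :: xs)).
  apply: evals_cons; first exact: evn.
  have {2}-> : xs = map (nth 0 xs) (iota 0 k).
    by rewrite map_nth_iota0 -sz // take_size.
  exact: evals_projections.
elim: (n xs) => [|i IHi] /=; first by apply/eval_rec0/evz.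
by apply: eval_recS IHi _; apply: evg; rewrite /= sz.
Qed.

Lemma nat_computable_if k b f g :
  nat_computable k b -> nat_computable k f -> nat_computable k g ->
  nat_computable k (fun xs => if b xs == 0 then f xs else g xs).
Proof.
move=> cb cf cg; apply: (nat_computable_ext (nat_computable_rec cb cf
  (nat_computable_behead (nat_computable_behead cg)))).
by move=> xs _; case: (b xs).
Qed.

Lemma nat_computable_mu k f h :
  nat_computable k.+1 f ->
  (forall xs, f (h xs :: xs) = 0 /\ forall i, i < h xs -> f (i :: xs) != 0) ->
  nat_computable k h.
Proof.
move=> [p pf] hP; exists (Mu p) => xs sz; have [h0 hmin] := hP xs.
apply: (@eval_mu _ _ _ (fun i => (f (i :: xs)).-1)) => [i /hmin fi|].
  by rewrite prednK ?lt0n //; apply: pf; rewrite /= sz.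
by rewrite -h0; apply: pf; rewrite /= sz.
Qed.

Section NatFunctions.
Variables (k : nat) (f g : seq nat -> nat).
Hypotheses (cf : nat_computable k f) (cg : nat_computable k g).

Lemma nat_computable_eq0 : nat_computable k (fun xs => f xs == 0).
Proof.
apply: (nat_computable_ext (nat_computable_if cf (nat_computable_const k 1)
  (nat_computable_const k 0))).
by move=> xs _; case: eqP.
Qed.

Lemma nat_computable_add : nat_computable k (fun xs => f xs + g xs).
Proof.
apply: (nat_computable_ext (nat_computable_rec cf cg
  (nat_computable_succ (nat_computable_nth _ 1)))).
by move=> xs _; elim: (f xs) => //= n ->.
Qed.

Lemma nat_computable_double : nat_computable k (fun xs => (f xs).*2).
Proof.
apply: (nat_computable_ext (nat_computable_rec cf (nat_computable0 k)
  (nat_computable_succ (nat_computable_succ (nat_computable_nth _ 1))))).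
by move=> xs _; elim: (f xs) => //= n ->.
Qed.

Lemma nat_computable_pred : nat_computable k (fun xs => (f xs).-1).
Proof.
apply: (nat_computable_ext (nat_computable_rec cf (nat_computable0 k)
  (nat_computable_nth _ 0))).
by move=> xs _; case: (f xs).
Qed.

End NatFunctions.

Lemma nat_computable_odd k f :
  nat_computable k f -> nat_computable k (fun xs => odd (f xs)).
Proof.
move=> cf; apply: (nat_computable_ext (nat_computable_rec cf (nat_computable0 k)
  (nat_computable_eq0 (nat_computable_nth _ 1)))).
by move=> xs _; elim: (f xs) => //= n ->; case: odd.
Qed.

Lemma nat_computable_half k f :
  nat_computable k f -> nat_computable k (fun xs => (f xs)./2).
Proof.
move=> cf; apply: (nat_computable_ext (nat_computable_rec cf (nat_computable0 k)
  (nat_computable_add (nat_computable_odd (nat_computable_nth _ 0))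
                      (nat_computable_nth _ 1)))).
move=> xs _; elim: (f xs) => //= n ->; rewrite uphalf_half //.
Qed.

Lemma nat_computable_sub k f g : nat_computable k f -> nat_computable k g ->
  nat_computable k (fun xs => f xs - g xs).
Proof.
move=> cf cg; apply: (nat_computable_ext (nat_computable_rec cg cf
  (nat_computable_pred (nat_computable_nth _ 1)))).
by move=> xs _; elim: (g xs) => [|n /= ->]; rewrite ?subn0 // subnS.
Qed.

Lemma nat_computable_eqn k f g : nat_computable k f -> nat_computable k g ->
  nat_computable k (fun xs => f xs == g xs).
Proof.
move=> cf cg; apply: (nat_computable_ext (nat_computable_eq0
  (nat_computable_add (nat_computable_sub cf cg) (nat_computable_sub cg cf)))).
by move=> xs _; rewrite addn_eq0 !subn_eq0 -eqn_leq.
Qed.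

Lemma nat_computable_iter_half k f g :
  nat_computable k f -> nat_computable k g ->
  nat_computable k (fun xs => iter (f xs) half (g xs)).
Proof.
move=> cf cg; apply: (nat_computable_ext (nat_computable_rec cf cg
  (nat_computable_half (nat_computable_nth _ 1)))).
by move=> xs _; elim: (f xs) => //= n ->.
Qed.

(** First entry and remainder of a sequence, read off its code. *)
Definition code_head c := nth 0 (CodeSeq.decode c) 0.
Definition code_behead c := CodeSeq.code (behead (CodeSeq.decode c)).

Lemma code_head_cons n s : code_head (CodeSeq.code (n :: s)) = n.
Proof. by rewrite /code_head CodeSeq.codeK. Qed.

Lemma code_behead_cons n s :
  code_behead (CodeSeq.code (n :: s)) = CodeSeq.code s.
Proof. by rewrite /code_behead CodeSeq.codeK. Qed.

Lemma nat_computable_cons k f g : nat_computable k f -> nat_computable k g ->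
  nat_computable k (fun xs => 2 ^ f xs * (g xs).*2.+1).
Proof.
move=> cf cg; apply: (nat_computable_ext (nat_computable_rec cf
  (nat_computable_succ (nat_computable_double cg))
  (nat_computable_double (nat_computable_nth _ 1)))).
move=> xs _; elim: (f xs) => [|n /= ->]; first by rewrite mul1n.
by rewrite expnS -mulnA mul2n.
Qed.

Lemma iter_half_pow2 i n m : i <= n -> iter i half (2 ^ n * m) = 2 ^ (n - i) * m.
Proof.
elim: i => [|i IHi] lt_in; first by rewrite subn0.
by rewrite /= IHi 1?ltnW // -(subnSK lt_in) expnS -mulnA mul2n doubleK.
Qed.

(** The code of [n :: s] is [2 ^ n] times an odd number, so [n] is the number of
    halvings after which an odd number appears. *)
Lemma code_head_least c :
  let stop n := (c == 0) || odd (iter n half c) in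
  stop (code_head c) /\ forall i, i < code_head c -> ~~ stop i.
Proof.
rewrite /= -[c]CodeSeq.decodeK; case: (CodeSeq.decode c) => [|n s].
  by split.
rewrite code_head_cons /= muln_eq0 expn_eq0 /=.
split=> [|i lt_in]; first by rewrite iter_half_pow2 // subnn mul1n /= odd_double.
rewrite iter_half_pow2 1?ltnW // oddM oddX orbF.
by rewrite eqn0Ngt subn_gt0 lt_in.
Qed.

Lemma nat_computable_code_head k f :
  nat_computable k f -> nat_computable k (fun xs => code_head (f xs)).
Proof.
move=> cf.
have cf' := nat_computable_behead cf.
apply: (@nat_computable_mu _ (fun ys =>
  if f (behead ys) == 0 then 0
  else (odd (iter (nth 0 ys 0) half (f (behead ys))) : nat) == 0)
  (fun xs => code_head (f xs))).
  apply: nat_computable_if => //; first exact: nat_computable0.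
  apply/nat_computable_eq0/nat_computable_odd/nat_computable_iter_half => //.
  exact: nat_computable_nth.
move=> xs /=; have [] := code_head_least (f xs).
set h := code_head _; move: h => h stop_h min_h; split=> [|i /min_h].
  by case: eqP stop_h => //= _ ->.
by case: eqP => //= _; case: odd.
Qed.

Lemma nat_computable_code_behead k f :
  nat_computable k f -> nat_computable k (fun xs => code_behead (f xs)).
Proof.
move=> cf; apply: (nat_computable_ext (nat_computable_half
  (nat_computable_iter_half (nat_computable_code_head cf) cf))) => xs _.
rewrite -[f xs]CodeSeq.decodeK; case: (CodeSeq.decode _) => [//|n s].
rewrite code_head_cons code_behead_cons /= iter_half_pow2 // subnn mul1n /=.
by rewrite uphalf_double.
Qed.

(** * Computable functions of encoded data *)

Class encodable (T : Type) := Encodable {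
  enc : T -> nat;
  dec : nat -> T;
  encK : cancel enc dec
}.

Lemma enc_inj T `{encodable T} : injective (enc (T := T)).
Proof. exact: can_inj encK. Qed.

#[export] Instance encodable_nat : encodable nat :=
  @Encodable nat id id (fun=> erefl).

#[export] Instance encodable_bool : encodable bool :=
  @Encodable bool nat_of_bool odd oddb.

Fact enc_seqK T `{encodable T} :
  cancel (fun s : seq T => CodeSeq.code (map enc s))
         (fun n => map dec (CodeSeq.decode n)).
Proof. by move=> s; rewrite CodeSeq.codeK mapK //; apply: encK. Qed.

#[export] Instance encodable_seq T `{encodable T} : encodable (seq T) :=
  Encodable (@enc_seqK T _).

Fact enc_pairK T U `{encodable T} `{encodable U} :
  cancel (fun x : T * U => CodeSeq.code [:: enc x.1; enc x.2])
         (fun n => (dec (code_head n), dec (code_head (code_behead n)))).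
Proof.
by case=> x y; rewrite code_head_cons code_behead_cons code_head_cons !encK.
Qed.

#[export] Instance encodable_pair T U `{encodable T} `{encodable U} :
  encodable (T * U) := Encodable (@enc_pairK T U _ _).

Lemma code_head_enc_fst T U `{encodable T} `{encodable U} (x : T * U) :
  code_head (enc x) = enc x.1.
Proof. exact: code_head_cons. Qed.

Lemma code_head_enc_snd T U `{encodable T} `{encodable U} (x : T * U) :
  code_head (code_behead (enc x)) = enc x.2.
Proof.
have -> : code_behead (enc x) = CodeSeq.code [:: enc x.2].
  exact: code_behead_cons.
exact: code_head_cons.
Qed.

(** Inductive rather than an abbreviation, so that matching a closure lemma with a
    goal compares the functions themselves and not their actions on codes, which
    can be convertible for functions of different types. *)
Variant computable X Y `{encodable X} `{encodable Y} (f : X -> Y) : Prop :=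
  Computable p of forall x, eval p [:: enc x] (enc (f x)).

Lemma nat_computable_pair : exists p, forall T U (eT : encodable T)
  (eU : encodable U) (x : T) (y : U), eval p [:: enc x; enc y] (enc (x, y)).
Proof.
have [p pP] := nat_computable_cons (nat_computable_nth 2 0)
  (nat_computable_cons (nat_computable_nth 2 1) (nat_computable0 2)).
by exists p => T U eT eU x y; apply: (pP [:: _; _]).
Qed.

Section Computable.
Context {X : Type} `{eX : encodable X}.

Lemma computable_ext Y `{encodable Y} (f g : X -> Y) :
  computable f -> f =1 g -> computable g.
Proof. by move=> [p pf] fg; exists p => x; rewrite -fg. Qed.

Lemma computable_id : computable (fun x : X => x).
Proof. by exists (Proj 0) => x; apply: (eval_proj 0 [:: enc x]). Qed.

Lemma computable_const Y `{encodable Y} (y : Y) : computable (fun _ : X => y).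
Proof.
by have [p pf] := nat_computable_const 1 (enc y); exists p => x; apply: pf.
Qed.

Lemma computable_comp Y Z `{encodable Y} `{encodable Z} (f : X -> Y) (g : Y -> Z) :
  computable f -> computable g -> computable (fun x => g (f x)).
Proof.
move=> [p pf] [q qg]; exists (Comp q [:: p]) => x.
apply: eval_comp (qg (f x)).
by apply: evals_cons => //; apply: evals_nil.
Qed.

Lemma computable_nat1 Y Z `{encodable Y} `{encodable Z}
    (h : seq nat -> nat) (f : X -> Y) (g : X -> Z) :
  nat_computable 1 h -> computable f ->
  (forall x, h [:: enc (f x)] = enc (g x)) -> computable g.
Proof.
move=> [p ph] [q qf] hE; exists (Comp p [:: q]) => x.
rewrite -hE; apply: (@eval_comp _ _ _ [:: enc (f x)]); last exact: ph.
by apply: evals_cons => //; apply: evals_nil.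
Qed.

Lemma computable_nat2 Y Y' Z `{encodable Y} `{encodable Y'} `{encodable Z}
    (h : seq nat -> nat) (f : X -> Y) (f' : X -> Y') (g : X -> Z) :
  nat_computable 2 h -> computable f -> computable f' ->
  (forall x, h [:: enc (f x); enc (f' x)] = enc (g x)) -> computable g.
Proof.
move=> [p ph] [q qf] [q' qf'] hE; exists (Comp p [:: q; q']) => x.
rewrite -hE; apply: (@eval_comp _ _ _ [:: enc (f x); enc (f' x)]); last exact: ph.
by apply: evals_cons => //; apply: evals_cons => //; apply: evals_nil.
Qed.

Lemma computable_succ (f : X -> nat) :
  computable f -> computable (fun x => (f x).+1).
Proof.
by move=> cf; apply: computable_nat1
  (nat_computable_succ (nat_computable_nth _ 0)) cf _.
Qed.

Lemma computable_double (f : X -> nat) :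
  computable f -> computable (fun x => (f x).*2).
Proof.
by move=> cf; apply: computable_nat1
  (nat_computable_double (nat_computable_nth _ 0)) cf _.
Qed.

Lemma computable_pair Y Z `{encodable Y} `{encodable Z} (f : X -> Y) (g : X -> Z) :
  computable f -> computable g -> computable (fun x => (f x, g x)).
Proof.
move=> cf cg; apply: computable_nat2 (nat_computable_cons
  (nat_computable_nth 2 0) (nat_computable_cons (nat_computable_nth 2 1)
  (nat_computable0 2))) cf cg _ => x //.
Qed.

Lemma computable_fst Y Z `{encodable Y} `{encodable Z} (f : X -> Y * Z) :
  computable f -> computable (fun x => (f x).1).
Proof.
move=> cf; apply: computable_nat1
  (nat_computable_code_head (nat_computable_nth 1 0)) cf _ => x.
exact: code_head_enc_fst.
Qed.

Lemma computable_snd Y Z `{encodable Y} `{encodable Z} (f : X -> Y * Z) :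
  computable f -> computable (fun x => (f x).2).
Proof.
move=> cf; apply: computable_nat1
  (nat_computable_code_head (nat_computable_code_behead (nat_computable_nth 1 0)))
  cf _ => x.
exact: code_head_enc_snd.
Qed.

Lemma computable_if Y `{encodable Y} (b : X -> bool) (f g : X -> Y) :
  computable b -> computable f -> computable g ->
  computable (fun x => if b x then f x else g x).
Proof.
move=> cb cf cg; have cfg := computable_pair cf cg.
apply: computable_nat2 (nat_computable_if (nat_computable_nth 2 0)
  (nat_computable_code_head (nat_computable_code_behead (nat_computable_nth 2 1)))
  (nat_computable_code_head (nat_computable_nth 2 1))) cb cfg _ => x.
case: (b x); [exact: (code_head_enc_fst (f x, g x))
             | exact: (code_head_enc_snd (f x, g x))].
Qed.

Lemma computable_negb (b : X -> bool) :
  computable b -> computable (fun x => ~~ b x).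
Proof.
by move=> cb; apply: computable_if => //; apply: computable_const.
Qed.

Lemma computable_andb (b c : X -> bool) :
  computable b -> computable c -> computable (fun x => b x && c x).
Proof. by move=> cb cc; apply: computable_if => //; apply: computable_const. Qed.

Lemma computable_eq (Y : eqType) `{encodable Y} (f g : X -> Y) :
  computable f -> computable g -> computable (fun x => f x == g x).
Proof.
move=> cf cg; apply: computable_nat2 (nat_computable_eqn
  (nat_computable_nth 2 0) (nat_computable_nth 2 1)) cf cg _ => x.
by rewrite /= (inj_eq (@enc_inj Y _)).
Qed.

Lemma computable_ltn (f g : X -> nat) :
  computable f -> computable g -> computable (fun x => f x < g x).
Proof.
move=> cf cg; apply: computable_nat2 (nat_computable_eq0 (nat_computable_sub
  (nat_computable_succ (nat_computable_nth 2 0)) (nat_computable_nth 2 1))) cf cg _.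
by move=> x; rewrite /= subn_eq0.
Qed.

Lemma computable_cons Y `{encodable Y} (f : X -> Y) (s : X -> seq Y) :
  computable f -> computable s -> computable (fun x => f x :: s x).
Proof.
by move=> cf cs; apply: computable_nat2 (nat_computable_cons
  (nat_computable_nth 2 0) (nat_computable_nth 2 1)) cf cs _.
Qed.

Lemma computable_behead Y `{encodable Y} (s : X -> seq Y) :
  computable s -> computable (fun x => behead (s x)).
Proof.
move=> cs; apply: computable_nat1
  (nat_computable_code_behead (nat_computable_nth 1 0)) cs _ => x.
by case: (s x) => // y s'; apply: code_behead_cons.
Qed.

Lemma computable_head Y `{encodable Y} (y : Y) (s : X -> seq Y) :
  computable s -> computable (fun x => head y (s x)).
Proof.
move=> cs; apply: computable_nat1 (nat_computable_if (nat_computable_nth 1 0)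
  (nat_computable_const 1 (enc y))
  (nat_computable_code_head (nat_computable_nth 1 0))) cs _ => x.
case: (s x) => [//|z s'] /=.
rewrite muln_eq0 expn_eq0 /=; exact: (code_head_cons (enc z) (map enc s')).
Qed.

Lemma computable_rec Y `{encodable Y} (n : X -> nat) (z : X -> Y)
    (g : X -> nat -> Y -> Y) :
  computable n -> computable z ->
  computable (fun u : X * (nat * Y) => g u.1 u.2.1 u.2.2) ->
  computable (fun x => iteri (n x) (g x) (z x)).
Proof.
move=> [pn evn] [pz evz] [pg evg].
have [q evq] := nat_computable_cons (nat_computable_nth 3 2)
  (nat_computable_cons (nat_computable_cons (nat_computable_nth 3 0)
    (nat_computable_cons (nat_computable_nth 3 1) (nat_computable0 3)))
  (nat_computable0 3)).
exists (Comp (PrimRec pz (Comp pg [:: q])) [:: pn; Proj 0]) => x.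
apply: (@eval_comp _ _ _ [:: n x; enc x]).
  apply: evals_cons => //; apply: evals_cons; last exact: evals_nil.
  exact: (eval_proj 0 [:: enc x]).
elim: (n x) => [|i IHi] /=; first exact/eval_rec0/evz.
apply: eval_recS IHi _.
apply: eval_comp (evg (x, (i, iteri i (g x) (z x)))).
by apply: evals_cons; [apply: (evq [:: _; _; _]) | apply: evals_nil].
Qed.

End Computable.

Lemma leq_size_enc T `{encodable T} (s : seq T) : size s <= enc s.
Proof.
rewrite /enc /=; elim: s => //= x s IHs.
apply: leq_trans (_ : _ <= (CodeSeq.code (map enc s)).*2.+1) _.
  by rewrite ltnS -addnn (leq_trans IHs) ?leq_addr.
by rewrite leq_pmull // expn_gt0.
Qed.

Section ComputableSeq.
Context {X : Type} `{eX : encodable X} {Y : Type} `{eY : encodable Y}.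

Lemma computable_foldl Z `{encodable Z} (s : X -> seq Y) (z : X -> Z)
    (g : X -> Z -> Y -> Z) :
  computable s -> computable z ->
  computable (fun u : X * (Z * Y) => g u.1 u.2.1 u.2.2) ->
  computable (fun x => foldl (g x) (z x) (s x)).
Proof.
move=> cs cz cg.
(* The state holds the entries still to be read and the accumulated value. The
   number of iterations is the code of the sequence, which bounds its length; once
   the sequence is exhausted the state no longer changes. *)
pose (step x (st : seq Y * Z) :=
  if enc st.1 == 0 then st else (behead st.1, g x st.2 (head (dec 0) st.1))).
have iterE x n t a : iteri n (fun=> step x) (t, a)
    = (drop n t, foldl (g x) a (take n t)).
  elim: n => [|n /= ->]; first by rewrite drop0 take0.
  rewrite /step; case: ifP => [/eqP/(@enc_inj _ _ _ [::]) /= d0|].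
    have le_tn : size t <= n by rewrite -subn_eq0 -size_drop d0.
    by rewrite !(take_oversize, drop_oversize) // leqW.
  case: (ltnP n (size t)) => [lt_nt _|le_tn].
    rewrite (take_nth (dec 0) lt_nt) foldl_rcons -nth0 nth_drop addn0.
    by rewrite -[in RHS]add1n -drop_drop drop1.
  by rewrite drop_oversize.
apply: (computable_ext (f := fun x =>
    (iteri (enc (s x)) (fun=> step x) (s x, z x)).2)); last first.
  by move=> x; rewrite iterE /= take_oversize ?leq_size_enc.
apply: computable_snd; apply: (computable_rec (g := fun x _ => step x)).
- by have [p pf] := cs; exists p.
- exact: computable_pair.
have cst : computable (fun u : X * (nat * (seq Y * Z)) => u.2.2).
  exact/computable_snd/computable_snd/computable_id.
rewrite /step; apply: computable_if => //.
  apply: computable_eq; last exact: computable_const.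
  by have [p pf] := computable_fst cst; exists p.
apply: computable_pair; first exact/computable_behead/computable_fst.
apply: (computable_comp (f := fun u : X * (nat * (seq Y * Z)) =>
  (u.1, (u.2.2.2, head (dec 0) u.2.2.1)))) cg.
apply: computable_pair; first exact/computable_fst/computable_id.
apply: computable_pair; first exact: computable_snd.
exact/computable_head/computable_fst.
Qed.

Lemma computable_rev (s : X -> seq Y) :
  computable s -> computable (fun x => rev (s x)).
Proof.
move=> cs; apply: (computable_ext
  (f := fun x => foldl (fun r y => y :: r) [::] (s x))).
  apply: (computable_foldl (g := fun _ r y => y :: r)) => //.
    exact: computable_const.
  apply: computable_cons; last exact/computable_fst/computable_snd/computable_id.
  exact/computable_snd/computable_snd/computable_id.
move=> x; rewrite /rev; move: [::].
by elim: (s x) => //= y t IHt r; rewrite IHt.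
Qed.

End ComputableSeq.

Section ComputableSeqOps.
Context {X : Type} `{eX : encodable X} {Y : Type} `{eY : encodable Y}.

Lemma computable_foldr Z `{encodable Z} (s : X -> seq Y) (z : X -> Z)
    (g : X -> Y -> Z -> Z) :
  computable s -> computable z ->
  computable (fun u : X * (Y * Z) => g u.1 u.2.1 u.2.2) ->
  computable (fun x => foldr (g x) (z x) (s x)).
Proof.
move=> cs cz cg; apply: (computable_ext
  (f := fun x => foldl (fun r y => g x y r) (z x) (rev (s x)))); last first.
  by move=> x; rewrite foldl_rev.
apply: (computable_foldl (g := fun x r y => g x y r)) => //.
  exact: computable_rev.
apply: (computable_comp (f := fun u : X * (Z * Y) => (u.1, (u.2.2, u.2.1)))) cg.
apply: computable_pair; first exact/computable_fst/computable_id.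
by apply: computable_pair; [apply: computable_snd | apply: computable_fst];
  apply/computable_snd/computable_id.
Qed.

Lemma computable_cat (s t : X -> seq Y) :
  computable s -> computable t -> computable (fun x => s x ++ t x).
Proof.
move=> cs ct; apply: (computable_ext (f := fun x => foldr cons (t x) (s x))).
  apply: (computable_foldr (g := fun=> cons)) => //.
  by apply: computable_cons; [apply: computable_fst | apply: computable_snd];
    apply/computable_snd/computable_id.
by move=> x; elim: (s x) => //= y r ->.
Qed.

Lemma computable_map Z `{encodable Z} (s : X -> seq Y) (g : X -> Y -> Z) :
  computable s -> computable (fun u : X * Y => g u.1 u.2) ->
  computable (fun x => map (g x) (s x)).
Proof.
move=> cs cg; apply: (computable_foldr (g := fun x y r => g x y :: r)) => //.
  exact: computable_const.
apply: computable_cons; last exact/computable_snd/computable_snd/computable_id.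
apply: (computable_comp (f := fun u : X * (Y * seq Z) => (u.1, u.2.1))) cg.
apply: computable_pair; first exact/computable_fst/computable_id.
exact/computable_fst/computable_snd/computable_id.
Qed.

Lemma computable_all (s : X -> seq Y) (b : X -> Y -> bool) :
  computable s -> computable (fun u : X * Y => b u.1 u.2) ->
  computable (fun x => all (b x) (s x)).
Proof.
move=> cs cb; apply: (computable_foldr (g := fun x y r => b x y && r)) => //.
  exact: computable_const.
apply: computable_andb; last exact/computable_snd/computable_snd/computable_id.
apply: (computable_comp (f := fun u : X * (Y * bool) => (u.1, u.2.1))) cb.
apply: computable_pair; first exact/computable_fst/computable_id.
exact/computable_fst/computable_snd/computable_id.
Qed.

Lemma computable_has (s : X -> seq Y) (b : X -> Y -> bool) :
  computable s -> computable (fun u : X * Y => b u.1 u.2) ->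
  computable (fun x => has (b x) (s x)).
Proof.
move=> cs cb.
apply: (computable_ext (f := fun x => ~~ all (fun y => ~~ b x y) (s x))).
  by apply/computable_negb/computable_all => //; apply: computable_negb.
by move=> x; rewrite -has_predC; apply: eq_has => y; rewrite /= negbK.
Qed.

Lemma computable_size (s : X -> seq Y) :
  computable s -> computable (fun x => size (s x)).
Proof.
move=> cs; apply: (computable_foldr (g := fun _ _ => S)) => //.
  exact: computable_const.
exact/computable_succ/computable_snd/computable_snd/computable_id.
Qed.

Lemma computable_nth (y : Y) (s : X -> seq Y) (i : X -> nat) :
  computable s -> computable i -> computable (fun x => nth y (s x) (i x)).
Proof.
move=> cs ci; apply: (computable_ext (f := fun x =>
  head y (iteri (i x) (fun=> behead) (s x)))).
  apply/computable_head/(computable_rec (g := fun=> fun=> behead)) => //.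
  exact/computable_behead/computable_snd/computable_snd/computable_id.
move=> x; rewrite -nth0 (_ : iteri _ _ _ = drop (i x) (s x)).
  by rewrite nth_drop addn0.
by elim: (i x) => [|n /= ->]; rewrite ?drop0 // -drop1 drop_drop.
Qed.

End ComputableSeqOps.

Lemma computable_mem {X : Type} `{eX : encodable X} (Y : eqType) `{encodable Y}
    (y : X -> Y) (s : X -> seq Y) :
  computable y -> computable s -> computable (fun x => y x \in s x).
Proof.
move=> cy cs; apply: (computable_ext (f := fun x => has (eq_op (y x)) (s x))).
  apply: (computable_has (b := fun x z => y x == z)) => //.
  apply: computable_eq; last exact/computable_snd/computable_id.
  exact: (computable_comp (computable_fst computable_id)).
by move=> x; rewrite -has_pred1; apply: eq_has => z; rewrite /= eq_sym.
Qed.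

Section ComputableSeqMore.
Context {X : Type} `{eX : encodable X}.

Lemma computable_flatten {Y} `{encodable Y} (s : X -> seq (seq Y)) :
  computable s -> computable (fun x => flatten (s x)).
Proof.
move=> cs; apply: (computable_foldr (g := fun=> cat)) => //.
  exact: computable_const.
by apply: computable_cat; [apply: computable_fst | apply: computable_snd];
  apply/computable_snd/computable_id.
Qed.

Lemma computable_iota (n : X -> nat) :
  computable n -> computable (fun x => iota 0 (n x)).
Proof.
move=> cn; apply: (computable_ext
  (f := fun x => iteri (n x) (fun i s => s ++ [:: i]) [::])).
  apply: (computable_rec (g := fun _ i s => s ++ [:: i])) => //.
    exact: computable_const.
  apply: computable_cat; first exact/computable_snd/computable_snd/computable_id.
  apply: computable_cons; last exact: computable_const.
  exact/computable_fst/computable_snd/computable_id.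
by move=> x; elim: (n x) => // i IHi; rewrite -[i.+1 in RHS]addn1 iotaD -IHi.
Qed.

End ComputableSeqMore.

(** * Semidecidable predicates and search *)

Definition semidecidable X `{encodable X} (S : X -> Prop) : Prop :=
  exists2 f : X * nat -> bool, computable f &
    forall x, S x <-> exists n, f (x, n).

Lemma semidecidable_ext X `{encodable X} (S T : X -> Prop) :
  semidecidable S -> (forall x, S x <-> T x) -> semidecidable T.
Proof. by move=> [f cf fS] ST; exists f => // x; rewrite -ST. Qed.

Section Semidecidable.
Context {X : Type} `{eX : encodable X}.

Lemma semidecidable_bool (b : X -> bool) :
  computable b -> semidecidable (fun x => b x).
Proof.
move=> cb; exists (fun u => b u.1).
  exact: (computable_comp (computable_fst computable_id)).
by move=> x; split=> [bx|[]//]; exists 0.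
Qed.

Lemma semidecidable_comp Y `{encodable Y} (S : Y -> Prop) (g : X -> Y) :
  semidecidable S -> computable g -> semidecidable (fun x => S (g x)).
Proof.
move=> [f cf fS] cg; exists (fun u => f (g u.1, u.2)) => [|x]; last exact: fS.
apply: (computable_comp (f := fun u : X * nat => (g u.1, u.2))) cf.
apply: computable_pair; last exact/computable_snd/computable_id.
exact: (computable_comp (computable_fst computable_id)).
Qed.

Lemma semidecidable_and (S T : X -> Prop) :
  semidecidable S -> semidecidable T -> semidecidable (fun x => S x /\ T x).
Proof.
move=> [f cf fS] [g cg gT].
exists (fun u => f (u.1, code_head u.2) && g (u.1, code_behead u.2)) => [|x].
  have cu2 : computable (fun u : X * nat => u.2).
    exact/computable_snd/computable_id.
  have cu1 : computable (fun u : X * nat => u.1).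
    exact/computable_fst/computable_id.
  apply: computable_andb; [apply: computable_comp cf|apply: computable_comp cg];
    apply: computable_pair => //.
    exact: computable_nat1 (nat_computable_code_head (nat_computable_nth 1 0)) cu2 _.
  exact: computable_nat1 (nat_computable_code_behead (nat_computable_nth 1 0)) cu2 _.
rewrite fS gT; split=> [[[m fm] [n gn]]|[n /andP[fn gn]]]; last first.
  by split; [exists (code_head n) | exists (code_behead n)].
exists (CodeSeq.code (m :: CodeSeq.decode n)).
by rewrite code_head_cons code_behead_cons CodeSeq.decodeK fm.
Qed.

(** Finitely many witnesses have a common bound, and this bound is the witness for
    the whole sequence. *)
Lemma semidecidable_all Y `{encodable Y} (s : X -> seq Y) (S : X -> Y -> Prop) :
  computable s -> semidecidable (fun u : X * Y => S u.1 u.2) ->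
  semidecidable (fun x => forall i, i < size (s x) -> S x (nth (dec 0) (s x) i)).
Proof.
move=> cs [f cf fS].
exists (fun u => all (fun y => has (fun m => f ((u.1, y), m)) (iota 0 u.2)) (s u.1)).
  apply: (computable_all (b := fun u y => has (fun m => f ((u.1, y), m)) (iota 0 u.2))).
    exact: (computable_comp (computable_fst computable_id)).
  apply: (computable_has (b := fun v m => f ((v.1.1, v.2), m))).
    exact/computable_iota/computable_snd/computable_fst/computable_id.
  apply: computable_comp cf; apply: computable_pair;
    last exact/computable_snd/computable_id.
  apply: computable_pair; last exact/computable_snd/computable_fst/computable_id.
  exact/computable_fst/computable_fst/computable_fst/computable_id.
move=> x /=; elim: (s x) => [|y t [IH1 IH2]]; first by split=> // _; exists 0.
split=> [St|[n /= /andP[/hasP[m _ fm] ft]] [_|i lt_it]]; last first.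
- by apply: IH2 => //; exists n.
- by apply/(fS (x, y)); exists m.
have [|n all_t] := IH1; first by move=> i lt_it; apply: (St i.+1).
have [|m fm] := (fS (x, y)).1; first exact: (St 0).
exists (maxn m.+1 n); apply/andP; split.
  by apply/hasP; exists m => //; rewrite mem_iota /= leq_max leqnn.
apply: sub_all all_t => z /hasP[k]; rewrite !mem_iota /= => lt_kn fk.
by apply/hasP; exists k => //; rewrite mem_iota /= leq_max lt_kn orbT.
Qed.

End Semidecidable.

(** Decoding is total, so running through all numbers runs through all of [T]; a
    search also needs to compute this enumeration. *)
Class searchable (T : Type) `{eT : encodable T} :=
  computable_dec : computable (dec (T := T)).
Arguments searchable T {eT}.

#[export] Instance searchable_nat : searchable nat.
Proof. exact: computable_id. Qed.

#[export] Instance searchable_seq T `{searchable T} : searchable (seq T).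
Proof.
apply: (computable_map (g := fun _ n => dec n)).
  have [p pf] := @computable_id nat _; exists p => n.
  have -> : enc (CodeSeq.decode n) = n by rewrite /enc /= map_id CodeSeq.decodeK.
  exact: pf.
exact: (computable_comp (computable_snd computable_id)).
Qed.

#[export] Instance searchable_pair T U `{searchable T} `{searchable U} :
  searchable (T * U)%type.
Proof.
have c1 := nat_computable_code_head (nat_computable_nth 1 0).
have c2 := nat_computable_code_head (nat_computable_code_behead (nat_computable_nth 1 0)).
by apply: computable_pair; apply: computable_comp computable_dec;
  [apply: computable_nat1 c1 computable_id _
  |apply: computable_nat1 c2 computable_id _].
Qed.

Section Search.
Context {X : Type} `{eX : encodable X} {Y : Type} `{sY : searchable Y}.

Lemma semidecidable_ex (S : X -> Y -> Prop) :
  semidecidable (fun u : X * Y => S u.1 u.2) ->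
  semidecidable (fun x => exists y, S x y).
Proof.
move=> [f cf fS].
exists (fun u => f ((u.1, (dec u.2 : Y * nat).1), (dec u.2 : Y * nat).2)).
  have cd : computable (fun u : X * nat => dec u.2 : Y * nat).
    exact: (computable_comp (computable_snd computable_id) computable_dec).
  apply: computable_comp cf; apply: computable_pair; last exact: computable_snd.
  apply: computable_pair; last exact: computable_fst.
  exact/computable_fst/computable_id.
move=> x; split=> [[y /(fS (x, y))[n fn]]|[n fn]].
  by exists (enc (y, n)); rewrite encK.
by exists (dec n : Y * nat).1; apply/(fS (x, _)); exists (dec n : Y * nat).2.
Qed.

(** Minimization over numbers that encode a candidate together with a witness for
    it. *)
Lemma search (S : X -> Y -> Prop) :
  semidecidable (fun u : X * Y => S u.1 u.2) ->
  exists p, forall x, (exists y, S x y) ->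
    exists2 y, S x y & eval p [:: enc x] (enc y).
Proof.
move=> [f cf fS].
have [q qf] : computable (fun u : nat * X =>
    ~~ f ((u.2, (dec u.1 : Y * nat).1), (dec u.1 : Y * nat).2)).
  have cd : computable (fun u : nat * X => dec u.1 : Y * nat).
    exact: (computable_comp (computable_fst computable_id) computable_dec).
  apply: computable_negb.
  apply: computable_comp cf; apply: computable_pair; last exact: computable_snd.
  apply: computable_pair; last exact: computable_fst.
  exact/computable_snd/computable_id.
have [r rP] : computable (fun n => (dec n : Y * nat).1).
  exact/computable_fst/computable_dec.
have [s sP] := nat_computable_cons (nat_computable_nth 2 0)
  (nat_computable_cons (nat_computable_nth 2 1) (nat_computable0 2)).
exists (Comp r [:: Mu (Comp q [:: s])]) => x [y /(fS (x, y))[m fm]].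
pose (P n := f ((x, (dec n : Y * nat).1), (dec n : Y * nat).2)).
have exP : exists n, P n by exists (enc (y, m)); rewrite /P encK.
have evP n : eval (Comp q [:: s]) [:: n; enc x] (~~ P n).
  apply: eval_comp (qf (n, x)).
  by apply: evals_cons; [apply: (sP [:: _; _]) | apply: evals_nil].
exists (dec (ex_minn exP) : Y * nat).1; case: ex_minnP => n Pn n_min.
  by apply/(fS (x, _)); exists (dec n : Y * nat).2.
apply: (@eval_comp _ _ _ [:: n]); last exact: rP.
apply: evals_cons; last exact: evals_nil.
apply: (eval_mu (v := fun=> 0)) => [i lt_in|]; last by have := evP n; rewrite Pn.
have := evP i; suff -> : ~~ P i by [].
by apply/negP => /n_min; rewrite leqNgt lt_in.
Qed.

End Search.

(** * Infinite cyclic quotients *)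

Local Open Scope group_scope.

Section Isomorphisms.
Variables G H : groupType.

Lemma isog_can (f : G -> H) (g : H -> G) :
  {morph f : x y / x * y} -> cancel f g -> cancel g f -> isog G H.
Proof.
move=> fM fK gK.
pose F : {multiplicative G -> H} := HB.pack f (isMultiplicative.Build G H f fM).
by exists F, g.
Qed.

Lemma isogP : isog G H -> exists (f : G -> H) (g : H -> G),
  [/\ {morph f : x y / x * y}, {morph g : x y / x * y}, cancel f g & cancel g f].
Proof.
move=> [f [g fK gK]]; exists f, g; split=> //; first exact: gmulfM.
exact: can2_gmulfM.
Qed.

Lemma morph1 (f : G -> H) : {morph f : x y / x * y} -> f 1 = 1.
Proof. by move=> fM; apply: (mulgI (f 1)); rewrite -fM !mulg1. Qed.

Lemma morphV (f : G -> H) : {morph f : x y / x * y} -> {morph f : x / x^-1}.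
Proof.
by move=> fM x; apply: (mulgI (f x)); rewrite -fM !mulgV morph1.
Qed.

Lemma morph_expz (f : G -> H) : {morph f : x y / x * y} ->
  forall x m, f (expz x m) = expz (f x) m.
Proof.
move=> fM x m; elim/int_rect: m => [|n IHn|n IHn].
- exact: morph1.
- by rewrite intS [(1 + _)%R]GRing.addrC !expzS fM IHn.
- by rewrite intS GRing.opprD [(-1 + _)%R]GRing.addrC !expzP fM IHn morphV.
Qed.

Lemma isog_inj_surj (f : G -> H) :
  {morph f : x y / x * y} -> (forall x, f x = 1 -> x = 1) ->
  (forall y, exists x, f x = y) -> isog G H.
Proof.
move=> fM f1 /choice[g gK]; apply: (isog_can fM _ gK) => x.
apply: (mulIg x^-1); rewrite mulgV; apply: f1.
by rewrite fM gK -fM mulgV morph1.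
Qed.

End Isomorphisms.

Lemma isog_refl (G : groupType) : isog G G.
Proof. exact: (isog_can (f := id) (g := id)). Qed.

Lemma isog_sym (G H : groupType) : isog G H -> isog H G.
Proof. by move=> /isogP[f [g [fM gM fK gK]]]; apply: (isog_can gM gK fK). Qed.

Lemma isog_trans (G H K : groupType) : isog G H -> isog H K -> isog G K.
Proof.
move=> /isogP[f [f' [fM _ fK f'K]]] /isogP[g [g' [gM _ gK g'K]]].
apply: (@isog_can _ _ (g \o f) (f' \o g')).
- by move=> x y /=; rewrite fM gM.
- exact: can_comp.
- exact: can_comp.
Qed.

Section EpiZ.
Variable G : groupType.
Implicit Type chi : G -> int.

Definition epi_Z chi : Prop :=
  (forall x y, chi (x * y) = (chi x + chi y)%R) /\ exists t, chi t = 1%R.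

Lemma epi_Z1 chi : epi_Z chi -> chi 1 = 0%R.
Proof.
move=> [chiM _]; apply: (GRing.addrI (chi 1)).
by rewrite -chiM mulg1 GRing.addr0.
Qed.

Lemma epi_ZV chi : epi_Z chi -> forall x, chi x^-1 = (- chi x)%R.
Proof.
move=> chi_epi x; apply: (GRing.addrI (chi x)).
by rewrite -chi_epi.1 mulgV epi_Z1 // GRing.addrN.
Qed.

Lemma epi_Z_expz chi : epi_Z chi ->
  forall x m, chi (expz x m) = (chi x * m)%R.
Proof.
move=> chi_epi x m; elim/int_rect: m => [|n IHn|n IHn].
- by rewrite GRing.mulr0; apply: epi_Z1.
- rewrite intS [(1 + _)%R]GRing.addrC expzS chi_epi.1 IHn.
  by rewrite GRing.mulrDr GRing.mulr1.
- rewrite intS GRing.opprD [(-1 + _)%R]GRing.addrC expzP chi_epi.1 IHn.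
  by rewrite epi_ZV // GRing.mulrDr GRing.mulrN1.
Qed.

Fact ker_Z_closed chi : epi_Z chi -> group_closed (fun x => chi x == 0%R).
Proof.
move=> chi_epi; split=> [|x y]; first by rewrite unfold_in epi_Z1.
by rewrite !unfold_in chi_epi.1 epi_ZV // => /eqP-> /eqP->.
Qed.

Fact ker_Z_conj chi : epi_Z chi ->
  forall x y : G, x \in (fun x => chi x == 0%R) -> x ^ y \in (fun x => chi x == 0%R).
Proof.
move=> chi_epi x y; rewrite !unfold_in !chi_epi.1 epi_ZV // => /eqP->.
by rewrite GRing.add0r GRing.addNr.
Qed.

Definition ker_Z chi (chi_epi : epi_Z chi) : normal_subgroup G :=
  NormalSubgroup (ker_Z_closed chi_epi) (ker_Z_conj chi_epi).

(** Trades quotients for homomorphisms to Z, which can be composed with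
    isomorphisms. *)
Lemma infinite_cyclic_quotientP (N : normal_subgroup G) :
  infinite_cyclic_quotient N <->
  exists2 chi, epi_Z chi & forall x, (x \in nsub N) = (chi x == 0%R).
Proof.
split=> [/isogP[f [g [fM gM fK gK]]]|[chi chi_epi chiN]].
  have cM x y : coset N (x * y) = coset N x * coset N y by rewrite -cosetM.
  exists (fun x => f (coset N x)) => [|x].
    split=> [x y|]; first by rewrite cM fM.
    by exists (repr (g 1%R)); rewrite /coset reprK gK.
  have f1 : f 1 = 0%R := morph1 fM.
  have -> : (x \in nsub N) = coset_rel N 1 x.
    by rewrite /coset_rel invg1 mul1g.
  apply/coset_eqP/eqP => [<- //|fx].
  by apply: (can_inj fK); rewrite fx.
have chi_repr x : chi (repr (coset N x)) = chi x.
  have : coset_rel N x (repr (coset N x)) by apply/coset_eqP; rewrite /coset reprK.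
  by rewrite /coset_rel chiN chi_epi.1 epi_ZV // GRing.addrC GRing.subr_eq0 => /eqP.
have [t chi_t] := chi_epi.2.
pose f (q : quotient_group N) : infinite_cyclic := chi (repr q).
pose g (m : infinite_cyclic) : quotient_group N := coset N (expz t m).
apply: (isog_can (f := f) (g := g)); rewrite /f /g.
- elim/cosetW=> x; elim/cosetW=> y.
  have -> : coset N x * coset N y = coset N (x * y) := cosetM N x y.
  by rewrite !chi_repr chi_epi.1.
- elim/cosetW=> x; rewrite chi_repr; apply/coset_eqP.
  rewrite /coset_rel chiN chi_epi.1 epi_ZV // epi_Z_expz // chi_t GRing.mul1r.
  by rewrite GRing.addNr.
- by move=> m; rewrite chi_repr epi_Z_expz // chi_t GRing.mul1r.
Qed.

Lemma only_Z_kernelP (N : normal_subgroup G) :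
  only_Z_kernel N <->
  (exists2 chi, epi_Z chi & forall x, (x \in nsub N) = (chi x == 0%R)) /\
  (forall chi, epi_Z chi -> forall x, (x \in nsub N) = (chi x == 0%R)).
Proof.
split=> [[/infinite_cyclic_quotientP NZ uniqN]|[NZ uniqN]]; split=> //.
- move=> chi chi_epi x; rewrite -(uniqN (ker_Z chi_epi)) //.
  by apply/infinite_cyclic_quotientP; exists chi.
- exact/infinite_cyclic_quotientP.
- move=> N' /infinite_cyclic_quotientP[chi chi_epi chiN'] x.
  by rewrite (uniqN chi) // chiN'.
Qed.

End EpiZ.

Lemma epi_Z_comp (G H : groupType) (f : G -> H) (g : H -> G) (chi : H -> int) :
  {morph f : x y / x * y} -> cancel g f -> epi_Z chi -> epi_Z (chi \o f).
Proof.
move=> fM gK [chiM [t chi_t]]; split=> [x y|]; first by rewrite /= fM chiM.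
by exists (g t); rewrite /= gK.
Qed.

(** * Mapping tori *)

Section Torus.
Variables (H : groupType) (a : automorphism H).

Definition fiber (h : H) : mapping_torus a := (h, 0%R).
Definition stable : mapping_torus a := (1, 1%R).

Lemma torusM (u v : mapping_torus a) : u * v = (u.1 * expz a u.2 v.1, (u.2 + v.2)%R).
Proof. by []. Qed.

Lemma fiberM : {morph fiber : x y / x * y}.
Proof. by move=> x y; rewrite torusM. Qed.

Lemma expz_stable m : expz stable m = (1, m) :> mapping_torus a.
Proof.
pose axis k : mapping_torus a := (1, k).
have axisM k l : axis k * axis l = axis (k + l)%R.
  by rewrite torusM aut_fun1 mulg1.
have stableV : stable^-1 = axis (-1)%R.
  by apply: (mulgI stable); rewrite mulgV [stable]/(axis 1%R) axisM.
rewrite -/(axis m); elim/int_rect: m => [|n IHn|n IHn] //.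
- by rewrite intS [(1 + _)%R]GRing.addrC expzS IHn axisM.
- by rewrite intS GRing.opprD [(-1 + _)%R]GRing.addrC expzP IHn stableV axisM.
Qed.

Lemma torusE (u : mapping_torus a) : u = fiber u.1 * expz stable u.2.
Proof.
by case: u => h m; rewrite expz_stable torusM /= mulg1 GRing.add0r.
Qed.

Lemma epi_Z_torus : epi_Z (snd : mapping_torus a -> int).
Proof. by split; last by exists stable. Qed.

Lemma fiber_conj (s : mapping_torus a) h :
  s * fiber h * s^-1 = fiber (s.1 * expz a s.2 h * s.1^-1).
Proof.
apply: (mulIg s); rewrite mulgVK !torusM /= GRing.addr0 GRing.add0r.
by rewrite mulgVK.
Qed.

Lemma derangedP :
  deranged a <->
  forall chi : mapping_torus a -> int, epi_Z chi ->
    forall u, (chi u == 0%R) = (u.2 == 0%R).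
Proof.
split=> [[N /only_Z_kernelP[_ uniqN]] chi chi_epi u|uniqZ].
  by rewrite -uniqN // (uniqN _ epi_Z_torus).
exists (ker_Z epi_Z_torus); apply/only_Z_kernelP; split.
  by exists snd; first exact: epi_Z_torus.
by move=> chi chi_epi u; rewrite uniqZ.
Qed.

(** The universal property: a homomorphism from the fibre together with an
    element that conjugates as the monodromy acts. *)
Section Universal.
Variables (G : groupType) (phi : H -> G) (s : G).
Hypotheses (phiM : {morph phi : x y / x * y})
  (phi_s : forall h, phi (a h) = s * phi h * s^-1).

Definition torus_map (u : mapping_torus a) : G := phi u.1 * expz s u.2.

Lemma phi_expz m h : phi (expz a m h) = expz s m * phi h * (expz s m)^-1.
Proof.
elim/int_rect: m h => [|n IHn|n IHn] h.
- by rewrite /= mul1g invg1 mulg1.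
- rewrite intS [(1 + _)%R]GRing.addrC !expzS autM IHn phi_s.
  by rewrite invgM !mulgA.
- rewrite intS GRing.opprD [(-1 + _)%R]GRing.addrC !expzP autM IHn.
  have -> : phi (a^-1 h) = s^-1 * phi h * s.
    by rewrite -[h in RHS](aut_invK a) phi_s !mulgA mulVg mul1g mulgVK.
  by rewrite invgM invgK !mulgA.
Qed.

Lemma torus_mapM : {morph torus_map : u v / u * v}.
Proof.
move=> u v; rewrite torusM /torus_map /= phiM phi_expz expzD !mulgA.
by rewrite mulgVK.
Qed.

Lemma torus_map_fiber h : torus_map (fiber h) = phi h.
Proof. by rewrite /torus_map /= mulg1. Qed.

Lemma torus_map_stable : torus_map stable = s.
Proof. by rewrite /torus_map /= morph1 // mul1g. Qed.

End Universal.

End Torus.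

(** A lift [t] of a generator of Z acts on the kernel by conjugation, and every
    element is uniquely the product of a kernel element and a power of [t]. *)
Lemma isog_torus (G H : groupType) (N : normal_subgroup G) :
  infinite_cyclic_quotient N -> isog H (subgroup N) ->
  exists a : automorphism H, isog G (mapping_torus a).
Proof.
move=> /infinite_cyclic_quotientP[chi chi_epi chiN].
move=> /isogP[f [g [fM gM fK gK]]].
have [t chi_t] := chi_epi.2.
pose phi h : G := val (f h).
have phiM : {morph phi : x y / x * y} by move=> x y; rewrite /phi fM.
have chi_phi h : chi (phi h) = 0%R by apply/eqP; rewrite -chiN; exact: (valP (f h)).
pose psi x := g (insubd 1 x).
have phiK : cancel phi psi by move=> h; rewrite /psi /phi valKd fK.
have psiK x : chi x = 0%R -> phi (psi x) = x.
  by move=> chi_x; rewrite /phi /psi gK insubdK // chiN chi_x.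
have chi_conj s h : chi (s * phi h * s^-1) = 0%R.
  by rewrite !chi_epi.1 chi_phi GRing.addr0 epi_ZV // GRing.addrN.
pose act s h := psi (s * phi h * s^-1).
have phi_act s h : phi (act s h) = s * phi h * s^-1 by rewrite psiK ?chi_conj.
have phi_inj : injective phi := can_inj phiK.
have actM : {morph act t : x y / x * y}.
  by move=> x y; apply: phi_inj; rewrite phiM !phi_act phiM !mulgA mulgVK.
have actK : cancel (act t) (act t^-1).
  move=> h; apply: phi_inj; rewrite !phi_act invgK !mulgA mulVg mul1g.
  by rewrite mulgVK.
have actVK : cancel (act t^-1) (act t).
  move=> h; apply: phi_inj; rewrite !phi_act invgK !mulgA mulgV mul1g.
  by rewrite mulgK.
pose a := Automorphism actM actK actVK.
have phi_s h : phi (a h) = t * phi h * t^-1 := phi_act t h.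
exists a; apply: isog_sym; apply: (isog_inj_surj (f := torus_map phi t)).
- exact: torus_mapM.
- move=> [h m]; rewrite /torus_map /= => e.
  have m0 : m = 0%R.
    have := congr1 chi e.
    by rewrite chi_epi.1 chi_phi epi_Z_expz // chi_t GRing.mul1r GRing.add0r epi_Z1.
  move: e; rewrite m0 mulg1 -(morph1 phiM) => /phi_inj->.
  reflexivity.
- move=> x; exists ((psi (x * expz t (- chi x)), chi x) : mapping_torus a).
  rewrite /torus_map /= psiK; first by rewrite expzN mulgVK.
  by rewrite chi_epi.1 epi_Z_expz // chi_t GRing.mul1r GRing.addrN.
Qed.

Lemma fiber_isog_kernel (G H : groupType) (a : automorphism H)
    (f : G -> mapping_torus a) (g : mapping_torus a -> G) (N : normal_subgroup G) :
  {morph g : x y / x * y} -> cancel f g -> cancel g f ->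
  (forall x, (x \in nsub N) = ((f x).2 == 0%R)) -> isog H (subgroup N).
Proof.
move=> gM fK gK fN.
have fiberN h : g (fiber a h) \in nsub N by rewrite fN gK.
apply: (isog_can (f := fun h => Subgroup (fiberN h)) (g := fun x => (f (val x)).1)).
- by move=> x y; apply: val_inj; rewrite /= fiberM gM.
- by move=> h /=; rewrite gK.
- move=> x; apply: val_inj; rewrite /= -[RHS]fK; congr g.
  have : val x \in nsub N := valP x.
  by rewrite fN; case: (f _) => h m /= /eqP->.
Qed.

(** Composing with the isomorphism matches the maps to Z of the two groups, and
    the kernel of the projection of the torus is its fibre. So uniqueness of the
    kernel is derangedness, and the kernel is presented by [P0]. *)
Lemma unique_by_Z_torus (F : presentation -> Prop) (P P0 : presentation)
    (a : automorphism (presented_group P0)) :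
  iso_closed F -> isog (presented_group P) (mapping_torus a) ->
  (unique_by_Z F P <-> deranged a /\ F P0).
Proof.
move=> F_closed /isogP[f [g [fM gM fK gK]]].
have f2_epi := epi_Z_comp fM gK (epi_Z_torus a).
split=> [[N [/only_Z_kernelP[_ uniqN] [P1 FP1 P1N]]]|[/derangedP a_der FP0]].
  split.
    apply/derangedP => chi chi_epi u; have chif_epi := epi_Z_comp fM gK chi_epi.
    by have := uniqN _ chif_epi (g u); rewrite (uniqN _ f2_epi) /= gK.
  apply: F_closed FP1 _; apply: isog_trans P1N _; apply: isog_sym.
  exact: fiber_isog_kernel gM fK gK (uniqN _ f2_epi).
exists (ker_Z f2_epi); split; last first.
  by exists P0 => //; apply: fiber_isog_kernel gM fK gK _.
apply/only_Z_kernelP; split; first by exists (snd \o f).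
move=> chi chi_epi x; have chig_epi := epi_Z_comp gM fK chi_epi.
by have := a_der _ chig_epi (f x); rewrite /= fK => ->.
Qed.

(** The fibre may be presented at will; this freedom is what later puts two groups
    over a common fibre. *)
Lemma unique_by_Z_decomposition (F : presentation -> Prop) (P : presentation) :
  unique_by_Z F P -> exists P0, F P0 /\
  forall P1, isog (presented_group P1) (presented_group P0) ->
    exists a : automorphism (presented_group P1),
      isog (presented_group P) (mapping_torus a).
Proof.
move=> [N [[N_Z _] [P0 FP0 P0N]]]; exists P0; split=> // P1 P10.
exact: isog_torus N_Z (isog_trans P10 P0N).
Qed.

Definition unit_int (e : int) : Prop := e = 1%R \/ e = (-1)%R.

(** For an isomorphism [theta] this says that [theta a theta^-1] is [b ^ e]
    followed by conjugation by [c]. *)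
Definition twisted_conjugacy (H K : groupType) (a : automorphism H) (b : automorphism K)
    (theta : H -> K) (c : K) (e : int) : Prop :=
  forall h, theta (a h) = c * expz b e (theta h) * c^-1.

(** The stable letter is sent to [(c, e)]. *)
Lemma torus_isog (H K : groupType) (a : automorphism H) (b : automorphism K)
    (theta : H -> K) (theta' : K -> H) (c : K) (e : int) :
  {morph theta : x y / x * y} -> cancel theta theta' -> cancel theta' theta ->
  unit_int e -> twisted_conjugacy a b theta c e ->
  isog (mapping_torus a) (mapping_torus b).
Proof.
move=> thetaM thetaK theta'K e1 conj_theta.
have ee : (e * e = 1)%R by case: e1 => ->.
pose s : mapping_torus b := (c, e).
pose phi h := fiber b (theta h).
have phiM : {morph phi : x y / x * y} by move=> x y; rewrite /phi thetaM fiberM.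
have phi_s h : phi (a h) = s * phi h * s^-1 by rewrite fiber_conj /phi conj_theta.
have snd_map u : (torus_map (a := a) phi s u).2 = (e * u.2)%R.
  have [sndM _] := epi_Z_torus b.
  by rewrite /torus_map sndM (epi_Z_expz (epi_Z_torus b)) GRing.add0r.
apply: (isog_inj_surj (f := torus_map (a := a) phi s)).
- exact: torus_mapM.
- move=> u u1; have u2 : u.2 = 0%R.
    have := snd_map u; rewrite u1 /= => /esym/(congr1 (fun m => e * m)%R).
    by rewrite GRing.mulrA ee GRing.mul1r GRing.mulr0.
  move: u1; rewrite /torus_map u2 mulg1 => -[t1].
  rewrite (torusE u) u2 mulg1; congr (_, _).
  by apply: (can_inj thetaK); rewrite t1 (morph1 thetaM).
- move=> v; pose w := v * (expz s (e * v.2)%R)^-1.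
  have w2 : w.2 = 0%R.
    have [sndM _] := epi_Z_torus b.
    rewrite /w sndM (epi_ZV (epi_Z_torus b)) (epi_Z_expz (epi_Z_torus b)) /=.
    by rewrite GRing.mulrA ee GRing.mul1r GRing.addrN.
  exists ((theta' w.1, (e * v.2)%R) : mapping_torus a).
  rewrite /torus_map /phi /= theta'K.
  have -> : fiber b w.1 = w by rewrite [RHS]torusE w2 mulg1.
  by rewrite /w mulgVK.
Qed.

(** Derangedness forces an isomorphism of tori to respect the fibres; it induces
    an automorphism of the quotient Z, so the stable letter goes to [(c, e)] with
    [e] invertible. *)
Lemma torus_isog_inv (H K : groupType) (a : automorphism H) (b : automorphism K) :
  deranged a -> isog (mapping_torus a) (mapping_torus b) ->
  exists (theta : H -> K) (theta' : K -> H) (c : K) (e : int),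
    [/\ {morph theta : x y / x * y}, cancel theta theta', cancel theta' theta,
        unit_int e & twisted_conjugacy a b theta c e].
Proof.
move=> /derangedP a_der /isogP[f [g [fM gM fK gK]]].
have f2_epi := epi_Z_comp fM gK (epi_Z_torus b).
have f_fiber h : f (fiber a h) = fiber b (f (fiber a h)).1.
  rewrite [LHS]torusE; have /eqP -> : (f (fiber a h)).2 == 0%R.
    by have := a_der _ f2_epi (fiber a h) => /= ->.
  by rewrite mulg1.
have g_fiber k : g (fiber b k) = fiber a (g (fiber b k)).1.
  rewrite [LHS]torusE; have /eqP -> : (g (fiber b k)).2 == 0%R.
    by rewrite -(a_der _ f2_epi (g (fiber b k))) /= gK.
  by rewrite mulg1.
exists (fun h => (f (fiber a h)).1), (fun k => (g (fiber b k)).1),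
  (f (stable a)).1, (f (stable a)).2; split.
- by move=> x y; rewrite fiberM fM f_fiber [f (fiber a y)]f_fiber -fiberM.
- by move=> h; rewrite -f_fiber fK.
- by move=> k; rewrite -g_fiber gK.
- have e1 : ((f (stable a)).2 * (g (stable b)).2 = 1)%R.
    have := congr1 snd (gK (stable b)).
    rewrite [g (stable b) in LHS]torusE fM (morph_expz fM).
    have [sndM _] := epi_Z_torus b.
    rewrite sndM (epi_Z_expz (epi_Z_torus b)).
    by rewrite f_fiber /= GRing.add0r.
  rewrite GRing.mulrC in e1.
  by case/orP: (intUnitRing.unitzPl e1) => /eqP->; [left|right].
- move=> h /=.
  have -> : fiber a (a h) = stable a * fiber a h * (stable a)^-1.
    by rewrite fiber_conj /= invg1 mul1g mulg1.
  rewrite !fM (morphV fM) f_fiber fiber_conj //.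
Qed.

(** Conjugacy of outer classes, written out on representatives: the inner
    ambiguity becomes the conjugating element [c]. *)
Lemma semi_conjugate_outerP (H : groupType) (a b : automorphism H) :
  semi_conjugate (outer_class a) (outer_class b) <->
  exists (z : automorphism H) (c : H) (e : int),
    unit_int e /\ twisted_conjugacy a b z c e.
Proof.
pose N := inner_automorphisms H.
have conjP (d : automorphism H) : conjugate (outer_class a) (outer_class d) <->
    exists (z : automorphism H) (c : H), twisted_conjugacy a d z c 1%R.
  have JE z : outer_class d ^ outer_class z = outer_class (d ^ z).
    rewrite /conjg /outer_class.
    have -> : (coset N z)^-1 = coset N z^-1 := cosetV N z.
    have -> : coset N d * coset N z = coset N (d * z) := cosetM N d z.
    exact: cosetM.
  split=> [[Z]|[z [c tc]]].
    elim/cosetW: Z => z; rewrite [_ ^ _]JE => /coset_eqP/asboolP[h hE].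
    exists z, (z (a h))^-1 => x.
    have := congr1 (fun x => z (a x)) (hE x).
    rewrite /conjg !autM !aut_funM !aut_funV !autV !aut_invK /= => ->.
    by rewrite invgK !mulgA mulVg mul1g mulgVK.
  exists (outer_class z); rewrite JE; apply/coset_eqP/asboolP.
  exists (aut_inv a (aut_inv z c^-1)) => x.
  apply: (can_inj (aut_funK a)); apply: (can_inj (aut_funK z)).
  rewrite /conjg !autM !aut_funM !aut_funV !autV !aut_invK tc /=.
  by rewrite invgK !mulgA mulVg mul1g mulgVK.
have VE : outer_class b^-1 = (outer_class b)^-1 := esym (cosetV N b).
rewrite /semi_conjugate -VE !conjP.
have exp1 (d : automorphism H) : expz d 1%R = d by [].
split=> [[|][z [c tc]]|[z [c [e [[->|->] tc]]]]].
- by exists z, c, 1%R; split; first by left.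
- by exists z, c, (-1)%R; split; first by right.
- by left; exists z, c.
- by right; exists z, c.
Qed.

Lemma torus_isog_semi_conjugate (H : groupType) (a b : automorphism H) :
  deranged a ->
  (isog (mapping_torus a) (mapping_torus b) <->
   semi_conjugate (outer_class a) (outer_class b)).
Proof.
move=> a_der; rewrite semi_conjugate_outerP; split.
  move=> /(torus_isog_inv a_der)[theta [theta' [c [e [tM tK t'K e1 tc]]]]].
  by exists (Automorphism tM tK t'K), c, e.
move=> [z [c [e [e1 tc]]]].
exact: (torus_isog (aut_funM z) (aut_funK z) (aut_invK z) e1 tc).
Qed.

Lemma torus_isog_fiber (H K : groupType) (a : automorphism H) (b : automorphism K) :
  deranged a -> isog (mapping_torus a) (mapping_torus b) -> isog H K.
Proof.
move=> a_der /(torus_isog_inv a_der)[theta [theta' [_ [_ [tM tK t'K _ _]]]]].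
exact: isog_can tM tK t'K.
Qed.

(** * Words as sequences of numbers *)

(** Letters are replaced by their codes: x_i is [i.*2] and its inverse is
    [i.*2.+1]. This removes the dependency of words on the number of generators,
    and adjoining a generator leaves the existing words unchanged. *)
Definition raw_presentation : Type := (nat * seq (seq nat))%type.

Definition raw_word n (w : word n) : seq nat := map (@code_letter n) w.

Definition raw (P : presentation) : raw_presentation :=
  (gens P, map (@raw_word (gens P)) (rels P)).

Lemma enc_raw_words n (ws : seq (word n)) :
  enc (map (@raw_word n) ws) = code_words ws.
Proof.
rewrite /enc /code_words /= -map_comp; congr CodeSeq.code.
by apply: eq_map => w; rewrite /= /code_word map_id.
Qed.

Lemma enc_raw P : enc (raw P) = code_presentation P.
Proof. by rewrite /code_presentation -enc_raw_words. Qed.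

Definition valid_word n (s : seq nat) : bool := all (fun c => c < n.*2)%N s.

Definition valid_presentation (p : raw_presentation) : bool :=
  all (valid_word p.1) p.2.

Lemma lt_code_letter n (x : letter n) : (code_letter x < n.*2)%N.
Proof.
case: x => [[i lt_in] b]; rewrite /code_letter /=.
by case: b; rewrite ?addn1 ?addn0 ?ltn_Sdouble ?ltn_double.
Qed.

Lemma valid_raw_word n (w : word n) : valid_word n (raw_word w).
Proof.
by apply/allP => c /mapP[x _ ->]; apply: lt_code_letter.
Qed.

Lemma half_lt n c : (c < n.*2)%N -> (c./2 < n)%N.
Proof. by rewrite ltn_half_double. Qed.

Lemma valid_wordP n s : valid_word n s -> exists w : word n, raw_word w = s.
Proof.
elim: s => [|c s IHs] /=; first by exists [::].
move=> /andP[lt_cn /IHs[w <-]].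
exists ((Ordinal (half_lt lt_cn), odd c) :: w).
by rewrite /= /code_letter /= addnC odd_double_half.
Qed.

Lemma valid_wordsP n (ss : seq (seq nat)) :
  all (valid_word n) ss -> exists ws : seq (word n), map (@raw_word n) ws = ss.
Proof.
elim: ss => [|s ss IHss] /=; first by exists [::].
by move=> /andP[/valid_wordP[w <-] /IHss[ws <-]]; exists (w :: ws).
Qed.

Lemma valid_raw P : valid_presentation (raw P).
Proof. by apply/allP => s /mapP[w _ ->]; apply: valid_raw_word. Qed.

Lemma valid_presentationP p :
  valid_presentation p -> exists P, raw P = p.
Proof.
case: p => n R; rewrite /valid_presentation /= => /valid_wordsP[R' <-].
by exists (@Presentation n R').
Qed.

Lemma raw_inj : injective raw.
Proof.
have code_letter_inj n : injective (@code_letter n).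
  move=> [i b] [j c]; rewrite /code_letter /= => e.
  have eb : b = c by move/(congr1 odd): e; rewrite !oddD !odd_double !oddb.
  by move: e; rewrite eb => /addIn/double_inj/val_inj->.
have raw_word_inj n : injective (@raw_word n) := inj_map (@code_letter_inj n).
move=> [n R] [m S] [nm]; move: S; rewrite -nm => S RS; congr Presentation.
exact: inj_map RS.
Qed.

Section RawEval.
Variable G : groupType.
Implicit Type psi : nat -> G.

Definition raw_eval psi (s : seq nat) : G := foldr (fun c g => psi c * g) 1 s.

Lemma raw_eval_cat psi s t : raw_eval psi (s ++ t) = raw_eval psi s * raw_eval psi t.
Proof. by elim: s => /= [|c s ->]; rewrite ?mul1g ?mulgA. Qed.

Lemma raw_eval_ext psi psi' s : psi =1 psi' -> raw_eval psi s = raw_eval psi' s.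
Proof. by move=> eq_psi; elim: s => //= c s ->; rewrite eq_psi. Qed.

Lemma eq_raw_eval n psi psi' s :
  (forall c, (c < n.*2)%N -> psi c = psi' c) -> valid_word n s ->
  raw_eval psi s = raw_eval psi' s.
Proof.
move=> eq_psi; elim: s => //= c s IHs /andP[].
by move=> /eq_psi-> /IHs->.
Qed.

End RawEval.

Lemma morph_raw_eval (G K : groupType) (f : G -> K) (psi : nat -> G) s :
  {morph f : x y / x * y} -> f (raw_eval psi s) = raw_eval (f \o psi) s.
Proof. by move=> fM; elim: s => /= [|c s <-]; rewrite ?morph1 ?fM. Qed.

(** Inverse letters are treated as generators of a monoid, with cancellation
    among the relators. A map given on all letters then extends to words by
    concatenation alone, and words never have to be inverted. *)
Definition cancellations n : seq (seq nat) :=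
  flatten [seq [:: [:: i.*2; i.*2.+1]; [:: i.*2.+1; i.*2]] | i <- iota 0 n].

Definition monoid_relators (p : raw_presentation) : seq (seq nat) :=
  p.2 ++ cancellations p.1.

(** The condition for a map on letters to induce a homomorphism. *)
Definition kills (G : groupType) (psi : nat -> G) (p : raw_presentation) : Prop :=
  forall r, r \in monoid_relators p -> raw_eval psi r = 1.

Lemma mem_cancellations n r : reflect
  (exists2 i, (i < n)%N & r = [:: i.*2; i.*2.+1] \/ r = [:: i.*2.+1; i.*2])
  (r \in cancellations n).
Proof.
apply: (iffP flatten_mapP) => [[i]|[i lt_in r_i]].
  rewrite mem_iota /= add0n !inE => lt_in /orP[]/eqP->; exists i => //; by [left|right].
by exists i; rewrite ?mem_iota // !inE; case: r_i => ->; rewrite eqxx ?orbT.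
Qed.

Lemma killsP (G : groupType) (psi : nat -> G) (p : raw_presentation) :
  (forall i, (i < p.1)%N -> psi i.*2.+1 = (psi i.*2)^-1) ->
  (forall r, r \in p.2 -> raw_eval psi r = 1) -> kills psi p.
Proof.
move=> psiV psi_rels r; rewrite mem_cat => /orP[/psi_rels //|].
by move=> /mem_cancellations[i /psiV e [->|->]]; rewrite /= e mulg1 ?mulgV ?mulVg.
Qed.

Lemma kills_inv (G : groupType) (psi : nat -> G) (p : raw_presentation) i :
  kills psi p -> (i < p.1)%N -> psi i.*2.+1 = (psi i.*2)^-1.
Proof.
move=> psi_p lt_in; have := psi_p [:: i.*2; i.*2.+1].
rewrite /= mulg1 => e; apply: (mulgI (psi i.*2)); rewrite mulgV; apply: e.
by rewrite mem_cat; apply/orP; right; apply/mem_cancellations; exists i => //; left.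
Qed.

Section PresentedRaw.
Variable P : presentation.

(** Total, so that it can be composed with maps on words without side conditions
    on the letters. *)
Definition letter_val (c : nat) : presented_group P :=
  if insub c./2 is Some i then word_val [:: (i, odd c)] else 1.

Lemma word_val_cat (u v : word (gens P)) :
  word_val (P := P) (u ++ v) = word_val (P := P) u * word_val (P := P) v.
Proof. by rewrite -word_valM. Qed.

Lemma letter_val_code (x : letter (gens P)) :
  letter_val (code_letter x) = word_val (P := P) [:: x].
Proof.
case: x => i b; rewrite /letter_val /code_letter /=.
by case: b; rewrite ?addn1 ?addn0 /= ?uphalf_double ?doubleK ?odd_double valK.
Qed.

Lemma letter_val_default c : (gens P).*2 <= c -> letter_val c = 1.
Proof.
move=> le_nc; rewrite /letter_val insubF //.
by rewrite ltnNge -(doubleK (gens P)) half_leq.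
Qed.

Lemma letter_val_gen i (lt_in : (i < gens P)%N) :
  letter_val i.*2 = generator (Ordinal lt_in).
Proof.
have := letter_val_code (Ordinal lt_in, false).
by rewrite /code_letter /= addn0.
Qed.

Lemma generatorE (i : 'I_(gens P)) : generator i = letter_val i.*2.
Proof.
by rewrite (letter_val_gen (ltn_ord i)); congr generator; apply: val_inj.
Qed.

Lemma raw_eval_letter_val (w : word (gens P)) :
  raw_eval letter_val (raw_word w) = word_val (P := P) w.
Proof.
elim: w => // x w IHw; rewrite -[x :: w]/([:: x] ++ w) word_val_cat -IHw.
by rewrite /= letter_val_code.
Qed.

Lemma kills_letter_val : kills letter_val (raw P).
Proof.
apply: killsP => [i lt_in|r /mapP[w w_rel ->]]; last first.
  by rewrite raw_eval_letter_val; apply/word_val_eqP/weq_rel.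
apply: (mulgI (letter_val i.*2)); rewrite mulgV.
have := letter_val_code (Ordinal lt_in, false).
have := letter_val_code (Ordinal lt_in, true).
rewrite /code_letter /= addn0 addn1 => -> ->; rewrite -word_val_cat.
exact/word_val_eqP/(weq_cancel (P := P) (Ordinal lt_in, false)).
Qed.

Lemma presented_hom_ext (G : groupType) (f g : presented_group P -> G) :
  {morph f : x y / x * y} -> {morph g : x y / x * y} ->
  (forall i, f (generator i) = g (generator i)) -> f =1 g.
Proof.
move=> fM gM fg; elim/word_valW=> w.
rewrite -raw_eval_letter_val !morph_raw_eval //.
apply: (eq_raw_eval (n := gens P)); last exact: valid_raw_word.
move=> c /half_lt lt_c; rewrite -(odd_double_half c) /=.
have e : f (letter_val c./2.*2) = g (letter_val c./2.*2).
  by rewrite (letter_val_gen lt_c).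
case: odd; rewrite ?add0n ?add1n //.
by rewrite (kills_inv kills_letter_val lt_c) !morphV // e.
Qed.

Lemma raw_eval_word_eq (G : groupType) (psi : nat -> G) (u v : word (gens P)) :
  kills psi (raw P) -> word_eq (P := P) u v ->
  raw_eval psi (raw_word u) = raw_eval psi (raw_word v).
Proof.
move=> psi_P; elim=> {u v} //.
- by move=> u v w _ -> _ ->.
- by move=> u u' v v' _ IHu _ IHv; rewrite /raw_word !map_cat !raw_eval_cat IHu IHv.
- move=> [i b]; apply: psi_P; rewrite mem_cat; apply/orP; right.
  apply/mem_cancellations; exists i => //.
  by rewrite /raw_word /code_letter /=; case: b; rewrite /= addn0 addn1; [right|left].
- move=> r r_rel; apply: psi_P; rewrite mem_cat; apply/orP; left; exact: map_f.
Qed.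

Lemma presented_hom (G : groupType) (psi : nat -> G) :
  kills psi (raw P) -> exists f : presented_group P -> G,
  {morph f : x y / x * y} /\ forall w, f (word_val w) = raw_eval psi (raw_word w).
Proof.
move=> psi_P; pose f (x : presented_group P) := raw_eval psi (raw_word (repr x)).
have fE w : f (word_val w) = raw_eval psi (raw_word w).
  by apply: raw_eval_word_eq => //; apply/word_val_eqP; rewrite /word_val reprK.
exists f; split=> //; elim/word_valW=> u; elim/word_valW=> v.
by rewrite -word_val_cat !fE /raw_word map_cat raw_eval_cat.
Qed.

End PresentedRaw.

Lemma presented_hom_letter (P : presentation) (G : groupType) (psi : nat -> G)
    (f : presented_group P -> G) :
  (forall w, f (word_val w) = raw_eval psi (raw_word w)) ->
  forall c, (c < (gens P).*2)%N -> f (letter_val P c) = psi c.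
Proof.
move=> fE c lt_c; have [|w w_c] := @valid_wordP (gens P) [:: c].
  by rewrite /= lt_c.
have := fE w; rewrite w_c /= mulg1 => <-; congr f.
by rewrite -raw_eval_letter_val w_c /= mulg1.
Qed.

(** * Derivations *)

(** [((x, y), (r, r'))] stands for the replacement of [x ++ r ++ y] by
    [x ++ r' ++ y]. *)
Definition replacement : Type := ((seq nat * seq nat) * (seq nat * seq nat))%type.

(** Both [r] and [r'] may be a relator or the empty word. This symmetry makes
    every step reversible. A replacement that does not apply leaves the word
    unchanged, so every sequence of replacements is a derivation. *)
Definition replace_factor (p : raw_presentation) (u : seq nat)
    (m : replacement) : seq nat :=
  if [&& m.2.1 \in [::] :: monoid_relators p, m.2.2 \in [::] :: monoid_relators p
       & u == m.1.1 ++ m.2.1 ++ m.1.2]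
  then m.1.1 ++ m.2.2 ++ m.1.2 else u.

Definition convertible p (u v : seq nat) : Prop :=
  exists ms, foldl (replace_factor p) u ms = v.

Section Convertible.
Variable p : raw_presentation.
Implicit Types u v w r : seq nat.

Lemma convertible_refl u : convertible p u u. Proof. by exists [::]. Qed.

Lemma convertible_trans v u w :
  convertible p u v -> convertible p v w -> convertible p u w.
Proof. by move=> [ms <-] [ns <-]; exists (ms ++ ns); rewrite foldl_cat. Qed.

Lemma convertible_replace x y r r' :
  r \in [::] :: monoid_relators p -> r' \in [::] :: monoid_relators p ->
  convertible p (x ++ r ++ y) (x ++ r' ++ y).
Proof.
move=> pr pr'; exists [:: ((x, y), (r, r'))].
by rewrite /= /replace_factor /= pr pr' eqxx.
Qed.

Lemma convertible_ind (Q : seq nat -> seq nat -> Prop) :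
  (forall u, Q u u) -> (forall v u w, Q u v -> Q v w -> Q u w) ->
  (forall x y r r', r \in [::] :: monoid_relators p ->
     r' \in [::] :: monoid_relators p -> Q (x ++ r ++ y) (x ++ r' ++ y)) ->
  forall u v, convertible p u v -> Q u v.
Proof.
move=> Q1 Qtrans Qstep u v [ms <-]; elim: ms u => //= m ms IHms u.
apply: Qtrans (IHms _); rewrite /replace_factor.
by case: ifP => // /and3P[pr pr' /eqP->]; apply: Qstep.
Qed.

Lemma convertible_sym u v : convertible p u v -> convertible p v u.
Proof.
apply: (convertible_ind (Q := fun u v => convertible p v u)) u v.
- exact: convertible_refl.
- by move=> v u w vu wv; apply: convertible_trans wv vu.
- by move=> x y r r' pr pr'; apply: convertible_replace.
Qed.

Lemma convertible_context x y u v :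
  convertible p u v -> convertible p (x ++ u ++ y) (x ++ v ++ y).
Proof.
apply: (convertible_ind
  (Q := fun u v => convertible p (x ++ u ++ y) (x ++ v ++ y))) u v.
- by move=> u; apply: convertible_refl.
- by move=> v u w uv vw; apply: convertible_trans uv vw.
- move=> x' y' r r' pr pr'.
  have := convertible_replace (x ++ x') (y' ++ y) pr pr'.
  by rewrite -!catA.
Qed.

Lemma convertible_cat u u' v v' :
  convertible p u u' -> convertible p v v' -> convertible p (u ++ v) (u' ++ v').
Proof.
move=> uu' vv'; apply: (@convertible_trans (u' ++ v)).
  exact: (convertible_context [::] v uu').
by have := convertible_context u' [::] vv'; rewrite !cats0.
Qed.

Lemma convertible_relator r : r \in monoid_relators p -> convertible p r [::].
Proof.
move=> pr; have := @convertible_replace [::] [::] r [::].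
by rewrite /= cats0; apply; rewrite ?mem_head // inE pr orbT.
Qed.

Lemma convertible_eval (G : groupType) (psi : nat -> G) u v :
  kills psi p -> convertible p u v -> raw_eval psi u = raw_eval psi v.
Proof.
move=> psi_p.
have psi1 r : r \in [::] :: monoid_relators p -> raw_eval psi r = 1.
  by rewrite inE => /orP[/eqP-> //|/psi_p].
apply: (convertible_ind (Q := fun u v => raw_eval psi u = raw_eval psi v)) u v.
- by [].
- by move=> v u w -> ->.
- by move=> x y r r' /psi1 r1 /psi1 r'1; rewrite !raw_eval_cat r1 r'1.
Qed.

End Convertible.

Lemma convertible_word_eq (P : presentation) (u v : word (gens P)) :
  word_eq (P := P) u v -> convertible (raw P) (raw_word u) (raw_word v).
Proof.
elim=> {u v}.
- by move=> u; apply: convertible_refl.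
- by move=> u v _; apply: convertible_sym.
- by move=> u v w _ uv _ vw; apply: convertible_trans uv vw.
- by move=> u u' v v' _ uu' _ vv'; rewrite /raw_word !map_cat; apply: convertible_cat.
- move=> [i b]; apply: convertible_relator; rewrite mem_cat; apply/orP; right.
  apply/mem_cancellations; exists i => //.
  by rewrite /raw_word /code_letter /=; case: b; rewrite /= addn0 addn1; [right|left].
- move=> r r_rel; apply: convertible_relator; rewrite mem_cat; apply/orP; left.
  exact: map_f.
Qed.

(** With [convertible_eval], derivations witness exactly the equations that hold
    in the presented group. *)
Lemma convertible_complete (P : presentation) (s t : seq nat) :
  valid_word (gens P) s -> valid_word (gens P) t ->
  raw_eval (letter_val P) s = raw_eval (letter_val P) t ->
  convertible (raw P) s t.
Proof.
move=> /valid_wordP[u <-] /valid_wordP[v <-]; rewrite !raw_eval_letter_val.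
by move=> /word_val_eqP; apply: convertible_word_eq.
Qed.

(** * Certificates of homomorphisms and isomorphisms *)

Definition substitute (us : seq (seq nat)) (s : seq nat) : seq nat :=
  flatten (map (nth [::] us) s).

Lemma raw_eval_substitute (G : groupType) (psi : nat -> G) us s :
  raw_eval psi (substitute us s) = raw_eval (fun c => raw_eval psi (nth [::] us c)) s.
Proof. by elim: s => //= c s IHs; rewrite /substitute /= raw_eval_cat -IHs. Qed.

(** The images of all letters are listed, inverse letters included. The relators
    are quantified through their positions, the form in which
    [semidecidable_all] applies; so are the generators in
    [inverse_certified]. *)
Definition hom_certified (p q : raw_presentation) (us : seq (seq nat)) : Prop :=
  size us = p.1.*2 /\
  forall i, (i < size (monoid_relators p))%N ->
    convertible q (substitute us (nth [::] (monoid_relators p) i)) [::].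

Definition inverse_certified (p : raw_presentation) (us vs : seq (seq nat)) : Prop :=
  forall i, (i < size (iota 0 p.1))%N ->
    convertible p (substitute vs (nth [::] us (nth 0%N (iota 0 p.1) i).*2))
      [:: (nth 0%N (iota 0 p.1) i).*2].

Definition iso_certified (p q : raw_presentation) (us vs : seq (seq nat)) : Prop :=
  (hom_certified p q us /\ hom_certified q p vs) /\
  (inverse_certified p us vs /\ inverse_certified q vs us).

(** On numbers that are not letters both sides are 1, the default image being
    the empty word. *)
Definition induces (P Q : presentation) (us : seq (seq nat))
    (f : presented_group P -> presented_group Q) : Prop :=
  forall c, f (letter_val P c) = raw_eval (letter_val Q) (nth [::] us c).

Lemma hom_certified_sound (P Q : presentation) us :
  hom_certified (raw P) (raw Q) us -> exists f : presented_group P -> presented_group Q,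
  {morph f : x y / x * y} /\ induces us f.
Proof.
move=> [sz us_rel].
have [|f [fM fE]] := @presented_hom P _
  (fun c => raw_eval (letter_val Q) (nth [::] us c)).
  move=> r r_rel; rewrite -raw_eval_substitute -[r](nth_index [::] r_rel).
  rewrite (convertible_eval (@kills_letter_val Q) (us_rel _ _)) //.
  by rewrite index_mem.
exists f; split=> // c; case: (ltnP c (gens P).*2) => [lt_c|le_c].
  exact: (presented_hom_letter fE).
by rewrite letter_val_default // morph1 // nth_default // sz.
Qed.

Lemma inverse_certified_sound (P Q : presentation) us vs
    (f : presented_group P -> presented_group Q)
    (g : presented_group Q -> presented_group P) :
  {morph f : x y / x * y} -> {morph g : x y / x * y} ->
  induces us f -> induces vs g -> inverse_certified (raw P) us vs -> cancel f g.
Proof.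
move=> fM gM fE gE inv_us.
apply: (@presented_hom_ext P _ (g \o f) id) => // [x y|i] /=; first by rewrite fM gM.
rewrite generatorE fE morph_raw_eval //.
have /(convertible_eval (@kills_letter_val P)) : convertible (raw P)
    (substitute vs (nth [::] us i.*2)) [:: i.*2].
  have := inv_us i; rewrite size_iota nth_iota ?add0n //; exact.
rewrite raw_eval_substitute /= mulg1 => <-.
by apply: raw_eval_ext => c; rewrite /= gE.
Qed.

Lemma iso_certified_sound (P Q : presentation) us vs :
  iso_certified (raw P) (raw Q) us vs ->
  exists (f : presented_group P -> presented_group Q)
    (g : presented_group Q -> presented_group P),
  [/\ {morph f : x y / x * y}, cancel f g, cancel g f & induces us f].
Proof.
move=> [[/hom_certified_sound[f [fM fE]] /hom_certified_sound[g [gM gE]]]].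
move=> [inv_us inv_vs].
exists f, g; split=> //; first exact: inverse_certified_sound fE gE inv_us.
exact: inverse_certified_sound gE fE inv_vs.
Qed.

Definition letter_images (P Q : presentation)
    (f : presented_group P -> presented_group Q) us :=
  [/\ size us = (gens P).*2, all (valid_word (gens Q)) us & induces us f].

Lemma valid_nth n us c : all (valid_word n) us -> valid_word n (nth [::] us c).
Proof.
move=> us_valid; case: (ltnP c (size us)) => [lt_c|le_c]; last by rewrite nth_default.
exact/(allP us_valid)/mem_nth.
Qed.

Lemma valid_substitute n us s : all (valid_word n) us -> valid_word n (substitute us s).
Proof.
move=> us_valid; elim: s => //= c s IHs.
by rewrite /substitute /= /valid_word all_cat -!/(valid_word _ _) valid_nth.
Qed.

(** The words for the generators can be prescribed; those for their inverses are
    chosen arbitrarily. *)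
Lemma exists_letter_images (P Q : presentation)
    (f : presented_group P -> presented_group Q)
    (ws : (gens P).-tuple (word (gens Q))) :
  {morph f : x y / x * y} ->
  (forall i, f (generator i) = word_val (tnth ws i)) ->
  exists2 us, letter_images f us &
    [seq nth [::] us i.*2 | i <- iota 0 (gens P)] = map (@raw_word _) ws.
Proof.
move=> fM fws.
pose img c := if odd c then raw_word (repr (f (letter_val P c)))
              else raw_word (nth [::] ws c./2).
have imgE c : (c < (gens P).*2)%N -> raw_eval (letter_val Q) (img c) = f (letter_val P c).
  move=> lt_c; rewrite /img; case: ifP => [_|even_c]; rewrite raw_eval_letter_val.
    by rewrite /word_val reprK.
  have /half_lt lt_c2 := lt_c.
  have := odd_double_half c; rewrite even_c add0n => {2}<-.
  by rewrite (letter_val_gen lt_c2) fws (tnth_nth [::]).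
exists (mkseq img (gens P).*2).
  split; first exact: size_mkseq.
    by apply/allP => s /mapP[c _ ->]; rewrite /img; case: ifP => _; apply: valid_raw_word.
  move=> c; case: (ltnP c (gens P).*2) => [lt_c|le_c].
    by rewrite nth_mkseq // imgE.
  by rewrite nth_default ?size_mkseq // letter_val_default // morph1.
have sz_ws : size ws = gens P by rewrite size_tuple.
apply: (@eq_from_nth _ [::]); first by rewrite !size_map size_iota sz_ws.
move=> i; rewrite size_map size_iota => lt_i.
rewrite (nth_map 0%N) ?size_iota // nth_iota // add0n nth_mkseq ?ltn_double //.
by rewrite /img odd_double doubleK (nth_map [::]) // sz_ws.
Qed.

Lemma exists_letter_images_hom (P Q : presentation)
    (f : presented_group P -> presented_group Q) :
  {morph f : x y / x * y} -> exists us, letter_images f us.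
Proof.
move=> fM; have [|us usf _] := @exists_letter_images P Q f
  [tuple repr (f (generator i)) | i < gens P] fM; last by exists us.
by move=> i; rewrite tnth_mktuple /word_val reprK.
Qed.

Lemma hom_certified_complete (P Q : presentation)
    (f : presented_group P -> presented_group Q) us :
  {morph f : x y / x * y} -> letter_images f us -> hom_certified (raw P) (raw Q) us.
Proof.
move=> fM [sz us_valid us_f]; split=> // i lt_i.
apply: convertible_complete => //; first exact: valid_substitute.
rewrite raw_eval_substitute [RHS]/=.
have := kills_letter_val (mem_nth [::] lt_i).
move=> /(congr1 f); rewrite morph_raw_eval // morph1 // => <-.
by apply: raw_eval_ext => c; rewrite /= us_f.
Qed.

Lemma inverse_certified_complete (P Q : presentation) us vs
    (f : presented_group P -> presented_group Q)
    (g : presented_group Q -> presented_group P) :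
  {morph g : x y / x * y} -> letter_images f us -> letter_images g vs ->
  cancel f g -> inverse_certified (raw P) us vs.
Proof.
move=> gM [_ _ us_f] [_ vs_valid vs_g] fK i; rewrite size_iota => lt_i.
rewrite nth_iota // add0n; apply: convertible_complete.
- exact: valid_substitute.
- by rewrite /= ltn_double lt_i.
rewrite raw_eval_substitute /= mulg1 -[RHS]fK us_f morph_raw_eval //.
by apply: raw_eval_ext => c; rewrite /= vs_g.
Qed.

Lemma iso_certified_complete (P Q : presentation)
    (f : presented_group P -> presented_group Q)
    (g : presented_group Q -> presented_group P) us :
  {morph f : x y / x * y} -> {morph g : x y / x * y} -> cancel f g -> cancel g f ->
  letter_images f us -> exists vs, iso_certified (raw P) (raw Q) us vs.
Proof.
move=> fM gM fK gK us_f; have [vs vs_g] := exists_letter_images_hom gM.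
exists vs; split; split.
- exact: hom_certified_complete us_f.
- exact: hom_certified_complete vs_g.
- exact: inverse_certified_complete us_f vs_g fK.
- exact: inverse_certified_complete vs_g us_f gK.
Qed.

(** * Presentations of mapping tori *)

(** The stable letter t has number [p.1]. Its relator with x_i reads
    w_i t x_i^-1 t^-1, which avoids inverting w_i. *)
Definition torus_raw (p : raw_presentation) (ws : seq (seq nat)) : raw_presentation :=
  (p.1.+1, p.2 ++ [seq nth [::] ws i ++ [:: p.1.*2; i.*2.+1; p.1.*2.+1]
                  | i <- iota 0 p.1]).

Lemma valid_word_widen m n s : (m <= n)%N -> valid_word m s -> valid_word n s.
Proof.
move=> le_mn; apply: sub_all => c lt_cm.
by rewrite (leq_trans lt_cm) // leq_double.
Qed.

Lemma valid_torus_raw p ws :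
  valid_presentation p -> all (valid_word p.1) ws -> valid_presentation (torus_raw p ws).
Proof.
move=> p_valid ws_valid; rewrite /valid_presentation all_cat; apply/andP; split.
  by apply: sub_all p_valid => s /=; apply: valid_word_widen.
apply/allP => s /mapP[i]; rewrite mem_iota /= add0n => lt_i ->.
rewrite /valid_word all_cat; apply/andP; split.
  exact: valid_word_widen (valid_nth i ws_valid).
by rewrite /= ltn_double ltnSn !ltn_Sdouble ltnSn ltnW.
Qed.

Lemma torus_presentation (P : presentation) (ws : images P) :
  exists T, raw T = torus_raw (raw P) (map (@raw_word _) ws).
Proof.
apply/valid_presentationP/valid_torus_raw; first exact: valid_raw.
by apply/allP => s /mapP[w _ ->]; apply: valid_raw_word.
Qed.

Section TorusPresentation.
Variables (P : presentation) (ws : images P) (a : automorphism (presented_group P)).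
Variable T : presentation.
Hypotheses (ws_a : represents ws a)
  (TE : raw T = torus_raw (raw P) (map (@raw_word _) ws)).

Let n := gens P.

Let gensT : gens T = n.+1. Proof. by have := congr1 fst TE. Qed.

Definition torus_letter (c : nat) : mapping_torus a :=
  if (c < n.*2)%N then fiber a (letter_val P c)
  else if c == n.*2 then stable a else (stable a)^-1.

Lemma raw_eval_torus_letter s :
  valid_word n s -> raw_eval torus_letter s = fiber a (raw_eval (letter_val P) s).
Proof.
rewrite (morph_raw_eval _ _ (fiberM a)); apply: eq_raw_eval => c.
by rewrite /torus_letter => ->.
Qed.

Lemma kills_torus_letter : kills torus_letter (raw T).
Proof.
have stableE : torus_letter n.*2 = stable a by rewrite /torus_letter ltnn eqxx.
have stableVE : torus_letter n.*2.+1 = (stable a)^-1.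
  by rewrite /torus_letter ltnNge leqnSn /= gtn_eqF.
have invE i : (i < n)%N -> torus_letter i.*2.+1 = (fiber a (letter_val P i.*2))^-1.
  move=> lt_i; rewrite /torus_letter ltn_Sdouble lt_i.
  by rewrite (kills_inv (@kills_letter_val P) lt_i) (morphV (fiberM a)).
rewrite TE; apply: killsP => [i|r] /=.
  rewrite ltnS leq_eqVlt => /orP[/eqP->|lt_i]; first by rewrite stableE stableVE.
  by rewrite invE // /torus_letter ltn_double lt_i.
rewrite mem_cat => /orP[/mapP[w w_rel ->]|/mapP[i]].
  rewrite raw_eval_torus_letter ?valid_raw_word // raw_eval_letter_val.
  by have -> : word_val (P := P) w = 1 by apply/word_val_eqP/weq_rel.
rewrite mem_iota /= add0n => lt_i ->.
rewrite raw_eval_cat /= stableE stableVE invE // (nth_map [::]) ?size_tuple //.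
rewrite raw_eval_torus_letter ?valid_raw_word // raw_eval_letter_val.
have -> : word_val (P := P) (nth [::] ws i) = a (letter_val P i.*2).
  by rewrite (letter_val_gen lt_i) ws_a (tnth_nth [::]).
rewrite mulg1 [stable a * _]mulgA -(morphV (fiberM a)) fiber_conj /=.
by rewrite invg1 mul1g mulg1 -fiberM aut_funV mulgV.
Qed.

(** The homomorphisms in both directions come from the universal properties of
    the presentation and of the torus. They are mutually inverse because they
    match generators with generators. *)
Lemma torus_presentation_isog : isog (presented_group T) (mapping_torus a).
Proof.
have [f [fM fE]] := presented_hom kills_torus_letter.
have fL := presented_hom_letter fE.
have killsT := @kills_letter_val T.
have lt_T c : (c < n.*2)%N -> (c < (gens T).*2)%N.
  by move=> lt_c; rewrite gensT doubleS !ltnS ltnW // ltnW.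
have [|emb [embM embE]] := @presented_hom P _ (letter_val T).
  apply: killsP => [i lt_i|r r_rel]; first by rewrite (kills_inv killsT) //= gensT ltnW.
  by apply: killsT; rewrite mem_cat TE mem_cat r_rel.
have embL := presented_hom_letter embE.
pose t := letter_val T n.*2.
have emb_t h : emb (a h) = t * emb h * t^-1.
  apply: (@presented_hom_ext P _ (emb \o a) (fun h => t * emb h * t^-1)).
  - by move=> x y /=; rewrite aut_funM embM.
  - by move=> x y; rewrite embM !mulgA mulgVK.
  move=> i /=; have lt_i := ltn_ord i.
  rewrite ws_a embE (tnth_nth [::]).
  rewrite generatorE.
  rewrite embL ?ltn_double //.
  have := killsT (raw_word (nth [::] ws i) ++ [:: n.*2; i.*2.+1; n.*2.+1]).
  rewrite raw_eval_cat /= mulg1.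
  rewrite !(kills_inv killsT) /= ?gensT ?ltnS // 1?ltnW //.
  move=> e; apply: (mulIg (t * (letter_val T i.*2)^-1 * t^-1)).
  rewrite !mulgA mulgVK mulgK mulgV -!mulgA; apply: e.
  rewrite mem_cat TE mem_cat; apply/orP; left; apply/orP; right; apply/mapP.
  by exists (i : nat); rewrite ?mem_iota // (nth_map [::]) // size_tuple.
pose F := torus_map (a := a) emb t.
have FM : {morph F : x y / x * y} := torus_mapM embM emb_t.
have f_emb h : f (emb h) = fiber a h.
  apply: (@presented_hom_ext P _ (f \o emb) (fiber a)) => [x y|x y|i] /=.
  - by rewrite embM fM.
  - exact: fiberM.
  have lt_i := ltn_ord i.
  rewrite generatorE.
  by rewrite embL ?ltn_double // fL ?lt_T ?ltn_double // /torus_letter ltn_double lt_i.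
have f_t : f t = stable a.
  by rewrite fL ?gensT ?ltn_double // /torus_letter ltnn eqxx.
apply: (isog_can (f := f) (g := F)) => //.
  apply: (@presented_hom_ext T _ (F \o f) id) => [x y||i] //=; first by rewrite fM FM.
  have lt_i := ltn_ord i.
  rewrite generatorE.
  rewrite fL ?ltn_double //; move: (nat_of_ord i) lt_i => {}i.
  rewrite gensT ltnS leq_eqVlt => /orP[/eqP e|lt_i].
    by rewrite e /torus_letter ltnn eqxx /F torus_map_stable.
  by rewrite /torus_letter ltn_double lt_i /F torus_map_fiber embL ?ltn_double.
by move=> u; rewrite /F /torus_map fM (morph_expz fM) f_emb f_t -torusE.
Qed.

End TorusPresentation.

(** * Certified decompositions *)

Definition generator_images (n : nat) (us : seq (seq nat)) : seq (seq nat) :=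
  [seq nth [::] us i.*2 | i <- iota 0 n].

(** The certificate for an isomorphism of [q] with itself is what makes the
    monodromy invertible. Without it the presentation [torus_raw q ws] might
    define an ascending extension, or one in which [q] does not embed. *)
Definition torus_certificate (p q : raw_presentation) (ws : seq (seq nat))
    (cert : (seq (seq nat) * seq (seq nat)) * (seq (seq nat) * seq (seq nat))) : Prop :=
  ([&& valid_presentation q, all (valid_word q.1) ws
     & ws == generator_images q.1 cert.1.1] /\
   iso_certified q q cert.1.1 cert.1.2) /\
  iso_certified p (torus_raw q ws) cert.2.1 cert.2.2.

Definition decomposes (p q : raw_presentation) (ws : seq (seq nat)) : Prop :=
  exists cert, torus_certificate p q ws cert.

Lemma decomposes_sound (P : presentation) q ws :
  decomposes (raw P) q ws ->
  exists (P0 : presentation) (ws0 : images P0) (a : automorphism (presented_group P0)),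
    [/\ raw P0 = q, map (@raw_word _) ws0 = ws, represents ws0 a
      & isog (presented_group P) (mapping_torus a)].
Proof.
move=> [[[us us'] [vs vs']] [[/= /and3P[]]]].
move=> /valid_presentationP[P0 <-] /= /valid_wordsP[w0 <-] /eqP ws_us.
have sz_w0 : size w0 == gens P0.
  by rewrite -(size_map (@raw_word _)) ws_us size_map size_iota.
move=> /iso_certified_sound[f [g [fM fK gK us_f]]].
pose a := Automorphism fM fK gK.
have w0_a : represents (Tuple sz_w0) a.
  move=> i /=; have lt_i := ltn_ord i.
  rewrite generatorE.
  rewrite us_f (tnth_nth [::]) /= -raw_eval_letter_val; congr raw_eval.
  have := congr1 (fun s => nth [::] s i) ws_us.
  rewrite (nth_map [::]) ?(eqP sz_w0) // => ->.
  by rewrite (nth_map 0%N) ?size_iota // nth_iota.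
have [T TE] := torus_presentation (Tuple sz_w0).
rewrite -[map _ w0]/(map _ (Tuple sz_w0)) -TE.
move=> /iso_certified_sound[f' [g' [f'M f'K g'K _]]].
exists P0, (Tuple sz_w0), a; split=> //.
apply: isog_trans (torus_presentation_isog w0_a TE); exact: isog_can f'M f'K g'K.
Qed.

Lemma decomposes_complete (P P0 : presentation) (a : automorphism (presented_group P0)) :
  isog (presented_group P) (mapping_torus a) ->
  exists ws, decomposes (raw P) (raw P0) ws.
Proof.
move=> P_a; pose ws : images P0 := [tuple repr (a (generator i)) | i < gens P0].
have ws_a : represents ws a by move=> i; rewrite tnth_mktuple /word_val reprK.
exists (map (@raw_word _) ws).
have [us us_a us_ws] := exists_letter_images (aut_funM a) ws_a.
have [us' a_iso] := iso_certified_complete (aut_funM a) (aut_invM a)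
  (aut_funK a) (aut_invK a) us_a.
have [T TE] := torus_presentation ws.
have /isogP[f [g [fM gM fK gK]]] :=
  isog_trans P_a (isog_sym (torus_presentation_isog ws_a TE)).
have [vs vs_f] := exists_letter_images_hom fM.
have [vs' f_iso] := iso_certified_complete fM gM fK gK vs_f.
exists ((us, us'), (vs, vs')); split; last by rewrite -TE.
split=> //; apply/and3P; split; first exact: valid_raw.
  by apply/allP => s /mapP[w _ ->]; apply: valid_raw_word.
by apply/eqP; rewrite -us_ws.
Qed.

(** * Semidecidability of decompositions *)

Ltac computable_step := first
  [ assumption
  | exact: computable_id
  | exact: computable_const
  | apply: computable_fst
  | apply: computable_snd
  | apply: computable_pair
  | apply: computable_succ
  | apply: computable_double
  | apply: computable_cons
  | apply: computable_cat
  | apply: computable_nth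
  | apply: computable_iota
  | apply: computable_size
  | apply: computable_flatten
  | apply: computable_mem
  | apply: computable_ltn
  | apply: computable_andb
  | apply: computable_eq
  | apply: computable_if ].

Section ComputableRaw.
Context {X : Type} `{encodable X}.

Lemma computable_torus_raw (p : X -> raw_presentation) (ws : X -> seq (seq nat)) :
  computable p -> computable ws -> computable (fun x => torus_raw (p x) (ws x)).
Proof.
move=> cp cws; apply: (computable_comp (f := fun x => (p x, ws x))
  (g := fun u => torus_raw u.1 u.2)); first exact: computable_pair.
rewrite /torus_raw; repeat computable_step.
apply: (computable_map (g := fun (u : raw_presentation * seq (seq nat)) i =>
  nth [::] u.2 i ++ [:: u.1.1.*2; i.*2.+1; u.1.1.*2.+1])); repeat computable_step.
Qed.

Lemma computable_monoid_relators (p : X -> raw_presentation) :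
  computable p -> computable (fun x => monoid_relators (p x)).
Proof.
move=> cp; apply: (computable_comp cp).
rewrite /monoid_relators /cancellations; repeat computable_step.
apply: (computable_map (g := fun (p : raw_presentation) i =>
  [:: [:: i.*2; i.*2.+1]; [:: i.*2.+1; i.*2]])); repeat computable_step.
Qed.

Lemma computable_substitute (us : X -> seq (seq nat)) (s : X -> seq nat) :
  computable us -> computable s -> computable (fun x => substitute (us x) (s x)).
Proof.
move=> cus cs; apply: (computable_comp (f := fun x => (us x, s x))
  (g := fun u => substitute u.1 u.2)); first exact: computable_pair.
rewrite /substitute; repeat computable_step.
apply: (computable_map (g := fun u : seq (seq nat) * seq nat => nth [::] u.1));
  repeat computable_step.
Qed.

Lemma computable_generator_images (n : X -> nat) (us : X -> seq (seq nat)) :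
  computable n -> computable us ->
  computable (fun x => generator_images (n x) (us x)).
Proof.
move=> cn cus; apply: (computable_comp (f := fun x => (n x, us x))
  (g := fun u => generator_images u.1 u.2)); first exact: computable_pair.
apply: (computable_map (g := fun (u : nat * seq (seq nat)) i => nth [::] u.2 i.*2));
  repeat computable_step.
Qed.

Lemma computable_valid_words (n : X -> nat) (ss : X -> seq (seq nat)) :
  computable n -> computable ss ->
  computable (fun x => all (valid_word (n x)) (ss x)).
Proof.
move=> cn css; apply: (computable_comp (f := fun x => (n x, ss x))
  (g := fun u => all (valid_word u.1) u.2)); first exact: computable_pair.
apply: (computable_all (b := fun (u : nat * seq (seq nat)) s => valid_word u.1 s));
  first by repeat computable_step.
apply: (computable_all (b := fun (v : nat * seq (seq nat) * seq nat) c =>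
  c < v.1.1.*2)%N); repeat computable_step.
Qed.

End ComputableRaw.

Ltac computability := repeat first
  [ apply: computable_torus_raw
  | apply: computable_monoid_relators
  | apply: computable_substitute
  | apply: computable_generator_images
  | apply: computable_valid_words
  | computable_step ].

Lemma semidecidable_convertible :
  semidecidable (fun u : raw_presentation * (seq nat * seq nat) =>
    convertible u.1 u.2.1 u.2.2).
Proof.
apply: (semidecidable_ex (S := fun (u : raw_presentation * (seq nat * seq nat))
  (ms : seq replacement) => foldl (replace_factor u.1) u.2.1 ms = u.2.2)).
apply: (semidecidable_ext (S := fun v :
    raw_presentation * (seq nat * seq nat) * seq replacement =>
  foldl (replace_factor v.1.1) v.1.2.1 v.2 == v.1.2.2)); last by move=> v; split=> /eqP.
apply: semidecidable_bool; apply: computable_eq; last by computability.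
apply: (computable_foldl (g := fun v :
    raw_presentation * (seq nat * seq nat) * seq replacement =>
  replace_factor v.1.1)); rewrite /replace_factor; computability.
Qed.

Lemma semidecidable_iso_certified :
  semidecidable (fun u : (raw_presentation * raw_presentation) *
      (seq (seq nat) * seq (seq nat)) => iso_certified u.1.1 u.1.2 u.2.1 u.2.2).
Proof.
have hom : semidecidable (fun u : (raw_presentation * raw_presentation) * seq (seq nat) =>
    hom_certified u.1.1 u.1.2 u.2).
  apply: semidecidable_and.
    apply: (semidecidable_ext (S := fun u :
      raw_presentation * raw_presentation * seq (seq nat) =>
      size u.2 == u.1.1.1.*2)); last by move=> u; split=> /eqP.
    by apply: semidecidable_bool; computability.
  apply: (semidecidable_all (S := fun
      (u : raw_presentation * raw_presentation * seq (seq nat)) r =>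
    convertible u.1.2 (substitute u.2 r) [::])); first by computability.
  apply: (semidecidable_comp semidecidable_convertible
    (g := fun v => (v.1.1.2, (substitute v.1.2 v.2, [::])))); computability.
have inv : semidecidable (fun u : raw_presentation * (seq (seq nat) * seq (seq nat)) =>
    inverse_certified u.1 u.2.1 u.2.2).
  apply: (semidecidable_all (S := fun
      (u : raw_presentation * (seq (seq nat) * seq (seq nat))) i =>
    convertible u.1 (substitute u.2.2 (nth [::] u.2.1 i.*2)) [:: i.*2])).
    by computability.
  apply: (semidecidable_comp semidecidable_convertible (g := fun v =>
    (v.1.1, (substitute v.1.2.2 (nth [::] v.1.2.1 v.2.*2), [:: v.2.*2]))));
    computability.
apply: semidecidable_and; apply: semidecidable_and.
- apply: (semidecidable_comp hom (g := fun u => (u.1, u.2.1))); computability.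
- apply: (semidecidable_comp hom (g := fun u => ((u.1.2, u.1.1), u.2.2))); computability.
- apply: (semidecidable_comp inv (g := fun u => (u.1.1, u.2))); computability.
- apply: (semidecidable_comp inv (g := fun u => (u.1.2, (u.2.2, u.2.1)))); computability.
Qed.

Definition certificate : Type :=
  ((seq (seq nat) * seq (seq nat)) * (seq (seq nat) * seq (seq nat)))%type.

Lemma semidecidable_decomposes :
  semidecidable (fun u : (raw_presentation * raw_presentation) * seq (seq nat) =>
    decomposes u.1.1 u.1.2 u.2).
Proof.
apply: (semidecidable_ex (S := fun
    (u : raw_presentation * raw_presentation * seq (seq nat))
  (cert : certificate) => torus_certificate u.1.1 u.1.2 u.2 cert)).
apply: semidecidable_and; first apply: semidecidable_and.
- by apply: semidecidable_bool; rewrite /valid_presentation; computability.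
- apply: (semidecidable_comp semidecidable_iso_certified (g := fun v =>
    ((v.1.1.2, v.1.1.2), v.2.1))); computability.
- apply: (semidecidable_comp semidecidable_iso_certified (g := fun v =>
    ((v.1.1.1, torus_raw v.1.1.2 v.1.2), v.2.2))); computability.
Qed.

(** * The two reductions *)

Lemma eval_projE i xs x : nth 0%N xs i = x -> eval (Proj i) xs x.
Proof. by move=> <-; apply: eval_proj. Qed.

Lemma eval_comp1 p q xs x y :
  eval q xs x -> eval p [:: x] y -> eval (Comp p [:: q]) xs y.
Proof.
move=> qx; apply: eval_comp.
by apply: evals_cons qx _; apply: evals_nil.
Qed.

Lemma eval_comp2 p q1 q2 xs x1 x2 y :
  eval q1 xs x1 -> eval q2 xs x2 -> eval p [:: x1; x2] y ->
  eval (Comp p [:: q1; q2]) xs y.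
Proof.
move=> qx1 qx2; apply: eval_comp.
by apply: evals_cons qx1 _; apply: evals_cons qx2 _; apply: evals_nil.
Qed.

Lemma eval_comp3 p q1 q2 q3 xs x1 x2 x3 y :
  eval q1 xs x1 -> eval q2 xs x2 -> eval q3 xs x3 -> eval p [:: x1; x2; x3] y ->
  eval (Comp p [:: q1; q2; q3]) xs y.
Proof.
move=> qx1 qx2 qx3; apply: eval_comp.
apply: evals_cons qx1 _; apply: evals_cons qx2 _; apply: evals_cons qx3 _.
exact: evals_nil.
Qed.

(** The words determine the automorphism, so the automorphisms quantified in the
    promise and in the answer of the semi-conjugacy problem are the same. *)
Lemma represents_inj (P : presentation) (ws : images P) a b :
  represents ws a -> represents ws b -> a = b.
Proof.
move=> ws_a ws_b; apply: autP; apply: presented_hom_ext (aut_funM a) (aut_funM b) _.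
by move=> i; rewrite ws_a ws_b.
Qed.

Lemma answer_semi_conjugate (P : presentation) (ws1 ws2 : images P) a b :
  represents ws1 a -> represents ws2 b ->
  @answer (deranged_semi_conjugacy_problem P) (ws1, ws2) <->
  semi_conjugate (outer_class a) (outer_class b).
Proof.
move=> ws_a ws_b; split=> [[a' [b' [/= ws_a' ws_b' ab]]]|]; last by exists a, b.
by rewrite (represents_inj ws_a ws_a') (represents_inj ws_b ws_b').
Qed.

Lemma isog_tori (P Q P0 : presentation) (a b : automorphism (presented_group P0)) :
  deranged a -> isog (presented_group P) (mapping_torus a) ->
  isog (presented_group Q) (mapping_torus b) ->
  isog (presented_group P) (presented_group Q) <->
  semi_conjugate (outer_class a) (outer_class b).
Proof.
move=> a_der Pa Qb; rewrite -torus_isog_semi_conjugate //; split=> [PQ|ab].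
  exact: isog_trans (isog_sym Pa) (isog_trans PQ Qb).
exact: isog_trans Pa (isog_trans ab (isog_sym Qb)).
Qed.

(** The algorithm builds the presentations of the two mapping tori and tests
    them for isomorphism; the promise of derangedness is what puts these tori
    into the family on which the test is correct. *)
Lemma semi_conjugacy_of_isomorphism (F : presentation -> Prop) :
  iso_closed F -> decidable_problem (isomorphism_problem (unique_by_Z F)) ->
  deranged_semi_conjugacy_decidable F.
Proof.
move=> F_closed [p pP].
have [q qP] : computable (fun u : raw_presentation * seq (seq nat) =>
    torus_raw u.1 u.2) by computability.
have [pr prP] := nat_computable_pair.
pose torus i := Comp q [:: Comp pr [:: Proj 0; Proj i]].
exists (Comp p [:: torus 1%N; torus 2%N]) => P FP [ws1 ws2].
move=> [a [b [/= ws_a ws_b a_der b_der]]].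
have torusP i (ws : images P) T xs :
    raw T = torus_raw (raw P) (map (@raw_word _) ws) ->
    nth 0%N xs 0 = code_presentation P -> nth 0%N xs i = code_words ws ->
    eval (torus i) xs (code_presentation T).
  move=> TE x0 xi.
  have := qP (raw P, map (@raw_word _) ws); rewrite -TE enc_raw.
  apply: eval_comp1; apply: eval_comp2 (eval_projE x0) (eval_projE xi) _.
  by rewrite -enc_raw -enc_raw_words; apply: prP.
have [T1 T1E] := torus_presentation ws1; have [T2 T2E] := torus_presentation ws2.
have T1_a := torus_presentation_isog ws_a T1E.
have T2_b := torus_presentation_isog ws_b T2E.
have [|yes no] := pP (T1, T2).
  by split; [apply/(unique_by_Z_torus F_closed T1_a)
            |apply/(unique_by_Z_torus F_closed T2_b)].
have evT y : eval p [:: code_presentation T1; code_presentation T2] y ->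
    eval (Comp p [:: torus 1%N; torus 2%N])
      [:: code_presentation P; code_words ws1; code_words ws2] y.
  by apply: eval_comp2; [apply: torusP T1E _ _ | apply: torusP T2E _ _].
have ansP := answer_semi_conjugate ws_a ws_b.
have torP := isog_tori a_der T1_a T2_b.
split=> [ans|ans]; apply: evT; first exact/yes/torP/ansP.
by apply: no => /torP/ansP.
Qed.

(** The fibre that the search returns need not be the presentation through
    which membership in the family was defined, but it presents the same
    kernel, so it belongs to F. *)
Lemma search_torus (F : presentation -> Prop) :
  iso_closed F -> exists s, forall P, unique_by_Z F P ->
  exists (P0 : presentation) (ws : images P0)
    (a : automorphism (presented_group P0)),
    [/\ F P0, represents ws a, deranged a,
        isog (presented_group P) (mapping_torus a)
      & eval s [:: code_presentation P] (enc (raw P0, map (@raw_word _) ws))].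
Proof.
move=> F_closed.
have [|s sP] := search
    (S := fun P (u : raw_presentation * seq (seq nat)) => decomposes P u.1 u.2).
  apply: (semidecidable_comp semidecidable_decomposes
    (g := fun v => ((v.1, v.2.1), v.2.2))); computability.
exists s => P FP.
have [|[r ws]] := sP (raw P).
  have [R0 [_ R0E]] := unique_by_Z_decomposition FP.
  have [a Pa] := R0E R0 (isog_refl _).
  by have [ws dec_ws] := decomposes_complete Pa; exists (raw R0, ws).
rewrite enc_raw /= => /decomposes_sound[P0 [ws0 [a [<- <- ws_a Pa]]]] ev.
have [a_der FP0] := (unique_by_Z_torus F_closed Pa).1 FP.
by exists P0, ws0, a.
Qed.

Lemma search_monodromy : exists s, forall P P0 : presentation,
  (exists b : automorphism (presented_group P0),
     isog (presented_group P) (mapping_torus b)) ->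
  exists (ws : images P0) (b : automorphism (presented_group P0)),
    [/\ represents ws b, isog (presented_group P) (mapping_torus b)
      & eval s [:: enc (raw P, raw P0)] (code_words ws)].
Proof.
have [s sP] := search
  (S := fun (u : raw_presentation * raw_presentation) ws =>
          decomposes u.1 u.2 ws) semidecidable_decomposes.
exists s => P P0 [b Pb].
have [ws] := sP (raw P, raw P0) (decomposes_complete Pb).
move=> /decomposes_sound[P1 [ws1 [b1 [/raw_inj P10]]]]; subst P1.
by move=> <- ws1_b1 Pb1; rewrite enc_raw_words => ev; exists ws1, b1.
Qed.

(** Decompose both groups as mapping tori and compare the fibres. If these are
    not isomorphic, neither are the groups. Otherwise the second group is also a
    torus over the fibre of the first, and the two monodromies can be
    compared. *)
Lemma isomorphism_of_semi_conjugacy (F : presentation -> Prop) :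
  iso_closed F -> decidable_problem (isomorphism_problem F) ->
  deranged_semi_conjugacy_decidable F ->
  decidable_problem (isomorphism_problem (unique_by_Z F)).
Proof.
move=> F_closed [pF pFP] [p pP].
have [s sP] := search_torus F_closed; have [s' s'P] := search_monodromy.
have [pfst fstP] := computable_fst (@computable_id
  (raw_presentation * seq (seq nat))%type _).
have [psnd sndP] := computable_snd (@computable_id
  (raw_presentation * seq (seq nat))%type _).
have [pr prP] := nat_computable_pair.
(* The second search diverges when the fibres are not isomorphic, so it must be
   started only after they have been compared: compare is the step of a
   primitive recursion on the outcome 0 or 1 of that comparison. As such a step
   it receives the counter 0 and the previous value 0 before the two inputs. *)
pose torus := Comp s [:: Proj 2].
pose compare := Comp p [:: Comp pfst [:: torus]; Comp psnd [:: torus];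
   Comp s' [:: Comp pr [:: Proj 3; Comp pfst [:: torus]]]].
pose fibre i := Comp pfst [:: Comp s [:: Proj i]].
exists (Comp (PrimRec Zero compare)
  [:: Comp pF [:: fibre 0%N; fibre 1%N]; Proj 0; Proj 1]).
move=> [P Q] [/= FP FQ].
have [P0 [ws [a [FP0 ws_a a_der Pa evP]]]] := sP P FP.
have [Q0 [ws' [a' [FQ0 _ a'_der Qa' evQ]]]] := sP Q FQ.
have [yes no] := pFP (P0, Q0) (conj FP0 FQ0).
have ev_fibre R R0 (us : images R0) i xs :
    nth 0%N xs i = code_presentation R ->
    eval s [:: code_presentation R] (enc (raw R0, map (@raw_word _) us)) ->
    eval (fibre i) xs (code_presentation R0).
  move=> xi ev_s; apply: eval_comp1; first exact: eval_comp1 (eval_projE xi) ev_s.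
  by rewrite -enc_raw; apply: fstP (raw R0, _).
have ev_iso y : eval pF [:: code_presentation P0; code_presentation Q0] y ->
    eval (Comp pF [:: fibre 0%N; fibre 1%N])
      [:: code_presentation P; code_presentation Q] y.
  by apply: eval_comp2; [apply: ev_fibre evP | apply: ev_fibre evQ].
have [P0Q0|nP0Q0] := pselect (isog (presented_group P0) (presented_group Q0));
  last first.
  split=> [PQ|_]; last first.
    apply: eval_comp3 (ev_iso _ (no nP0Q0)) (eval_proj _ _) (eval_proj _ _) _.
    exact/eval_rec0/eval_zero.
  case: nP0Q0; apply: (torus_isog_fiber a_der).
  exact: isog_trans (isog_sym Pa) (isog_trans PQ Qa').
have [|ws1 [b [ws1_b Qb ev_b]]] := s'P Q P0.
  have [R0 [_ R0E]] := unique_by_Z_decomposition FQ.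
  have [c Qc] := R0E R0 (isog_refl _).
  apply: R0E; apply: isog_trans P0Q0 _.
  exact: torus_isog_fiber a'_der (isog_trans (isog_sym Qa') Qc).
have [b_der _] := (unique_by_Z_torus F_closed Qb).1 FQ.
have ansP := answer_semi_conjugate ws_a ws1_b.
have torP := isog_tori a_der Pa Qb.
have [|yes2 no2] := pP P0 FP0 (ws, ws1); first by exists a, b.
have ev_all y :
    eval p [:: code_presentation P0; code_words ws; code_words ws1] y ->
    eval (Comp (PrimRec Zero compare)
      [:: Comp pF [:: fibre 0%N; fibre 1%N]; Proj 0; Proj 1])
      [:: code_presentation P; code_presentation Q] y.
  move=> ev_y.
  apply: eval_comp3 (ev_iso _ (yes P0Q0)) (eval_proj _ _) (eval_proj _ _) _ => /=.
  apply: eval_recS (eval_rec0 _ (eval_zero _)) _.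
  have ev_torus :
      eval torus [:: 0%N; 0%N; code_presentation P; code_presentation Q]
        (enc (raw P0, map (@raw_word _) ws)).
    exact: (eval_comp1 (eval_projE _) evP).
  apply: eval_comp3 ev_y.
  - by apply: eval_comp1 ev_torus _; rewrite -enc_raw; apply: fstP (raw P0, _).
  - by apply: eval_comp1 ev_torus _; rewrite -enc_raw_words; apply: sndP (raw P0, _).
  - apply: eval_comp1 ev_b.
    have ev_pr : eval pr [:: code_presentation Q; enc (raw P0)]
        (enc (raw Q, raw P0)) by rewrite -enc_raw; apply: prP.
    apply: eval_comp2 (eval_projE _) _ ev_pr => //.
    by apply: eval_comp1 ev_torus _; apply: fstP (raw P0, _).
split=> [ans|ans]; apply: ev_all; first exact/yes2/ansP/torP.
by apply: no2 => /ansP/torP.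
Qed.

Theorem theorem8p12 (F : presentation -> Prop) (F_closed : iso_closed F)
    (F_iso : decidable_problem (isomorphism_problem F)) :
  decidable_problem (isomorphism_problem (unique_by_Z F)) <->
  deranged_semi_conjugacy_decidable F.
Proof.
split; first exact: semi_conjugacy_of_isomorphism.
exact: isomorphism_of_semi_conjugacy.
Qed.
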